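(* Suppose $\mathrm{char}(\mathbb{F}_q)\neq2$. Let $V=\mathbb{F}_q^2\otimes\mathrm{Sym}^2(\mathbb{F}_q^2)$ be the space of pairs of binary quadratic forms with the action of $G=\mathrm{GL}_2(\mathbb{F}_q)\times\mathrm{GL}_2(\mathbb{F}_q)$, with $G$-orbits $\mathcal{O}_1,\dots,\mathcal{O}_7$ having the representatives $(0,0)$, $(0,v^2)$, $(0,uv)$, $(0,u^2-lv^2)$, $(v^2,uv)$, $(v^2,u^2)$, $(uv,u^2+lv^2)$ respectively ($l\in\mathbb{F}_q^\times$ a non-square), and let $e_i$ be the indicator function of $\mathcal{O}_i$. Let $M=[a_{ij}]$ be the matrix defined by $\widehat{e_j}=\sum_ia_{ij}e_i$. Then $q^6M$ equals $$\begin{bmatrix} 1&(q-1)(q+1)^2&\frac{(q-1)(q+1)^2q}{2}&\frac{(q-1)^2q(q+1)}2&(q+1)^2q(q-1)^2&\frac{(q+1)^2q^2(q-1)^2}2&\frac{(q-1)^3q^2(q+1)}2\\ 1&q^2-q-1&\frac{q(2q+1)(q-1)}2&-\frac{q(q-1)}2&(q^2-q-1)q(q-1)&-\frac{q^2(q-1)(q+1)}2&-\frac{q^2(q-1)^2}2\\ 1&(2q+1)(q-1)&\frac{q(q^2-2q-1)}2&\frac{q(q-1)^2}2&-(q-1)(q+1)q&\frac{q^2(q-1)^2}2&-\frac{q^2(q-1)^2}2\\ 1&-q-1&\frac{(q-1)(q+1)q}2&\frac{(q^2+1)q}2&-(q-1)(q+1)q&-\frac{q^2(q-1)(q+1)}2&\frac{q^2(q-1)(q+1)}2\\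 1&q^2-q-1&-\frac{(q+1)q}2&-\frac{q(q-1)}2&q&-\frac{q^2(q-1)}2&\frac{q^2(q-1)}2\\ 1&-q-1&\frac{q(q-1)}2&-\frac{q(q-1)}2&-q(q-1)&q^2&0\\ 1&-q-1&-\frac{(q+1)q}2&\frac{(q+1)q}2&(q+1)q&0&-q^2 \end{bmatrix}.$$
   Context: $p=\mathrm{char}(\mathbb{F}_q)\neq2$. Elements of $V$ are pairs $x=(A,B)$ of binary quadratic forms in $u,v$ over $\mathbb{F}_q$, also regarded as pairs of symmetric $2\times2$ matrices. $G$ acts by $\left(\begin{bmatrix}\alpha&\beta\\ \gamma&\delta\end{bmatrix},g_2\right)\circ(A,B)=(\alpha g_2Ag_2^T+\beta g_2Bg_2^T,\ \gamma g_2Ag_2^T+\delta g_2Bg_2^T)$. The seven orbits listed are distinct and exhaust $V$. For binary forms $A=au^2+buv+cv^2$, $A'=a'u^2+b'uv+c'v^2$ put $[A,A']'=aa'+bb'/2+cc'$, and $[(A,B),(A',B')]=[A,A']'+[B,B']'$. For $\phi\colon V\to\mathbb{C}$ the Fourier transform is $$\widehat\phi(y)=q^{-6}\sum_{x\in V}\phi(x)\exp\left(2\pi\sqrt{-1}\cdot\mathrm{Tr}_{\mathbb{F}_q/\mathbb{F}_p}([x,y])/p\right).$$ *)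

(* Defs.v *)
From HB Require Import structures.
From mathcomp Require Import all_boot all_order all_fingroup all_algebra all_field.
From mathcomp Require Import complex reals sequences exp trigo.

Set Implicit Arguments.
Unset Strict Implicit.
Unset Printing Implicit Defensive.

Import GRing.Theory.
Local Open Scope ring_scope.

(* The triple (a, b, c) is the form a u^2 + b u v + c v^2. *)
Definition bqf (F : finFieldType) : finType := (F * F * F)%type.

Definition bqf_pair (F : finFieldType) : finType := (bqf F * bqf F)%type.

Section Forms.

Variable F : finFieldType.
Implicit Types (A B : bqf F) (x y : bqf_pair F) (S : 'M[F]_2).

Definition mkbqf (a b c : F) : bqf F := (a, b, c).
Definition cuu A : F := A.1.1.
Definition cuv A : F := A.1.2.
Definition cvv A : F := A.2.

Definition bqf_mx A : 'M[F]_2 :=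
  \matrix_(i, j) (if i != j then cuv A / 2%:R
                  else if i == 0 then cuu A else cvv A).

(* The form (u v) S (u v)^T. *)
Definition mx_bqf S : bqf F := mkbqf (S 0 0) (S 0 1 + S 1 0) (S 1 1).

Lemma bqf_mxK A : 2%:R != 0 :> F -> mx_bqf (bqf_mx A) = A.
Proof.
case: A => [[a b] c] two0.
by rewrite /mx_bqf !mxE /= /cuv /= -mulr2n -[_ *+ 2]mulr_natr divfK.
Qed.

Definition act (g : {'GL_2[F]} * {'GL_2[F]}) x : bqf_pair F :=
  let g1 := GLval g.1 in
  let g2 := GLval g.2 in
  let A := g2 *m bqf_mx x.1 *m g2^T in
  let B := g2 *m bqf_mx x.2 *m g2^T in
  (mx_bqf (g1 0 0 *: A + g1 0 1 *: B), mx_bqf (g1 1 0 *: A + g1 1 1 *: B)).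

Definition orbitG x : {set bqf_pair F} :=
  [set act g x | g : {'GL_2[F]} * {'GL_2[F]}].

Definition orbit_reps (l : F) : seq (bqf_pair F) :=
  let zero := mkbqf 0 0 0 in
  let u2 := mkbqf 1 0 0 in
  let uv := mkbqf 0 1 0 in
  let v2 := mkbqf 0 0 1 in
  [:: (zero, zero);
      (zero, v2);
      (zero, uv);
      (zero, mkbqf 1 0 (- l));
      (v2, uv);
      (v2, u2);
      (uv, mkbqf 1 0 l)].

(* Indices start at 0: O_(i+1) is calO l i. *)
Definition calO (l : F) (i : 'I_7) : {set bqf_pair F} :=
  orbitG (nth (mkbqf 0 0 0, mkbqf 0 0 0) (orbit_reps l) i).

Definition bqf_dot A B : F :=
  cuu A * cuu B + cuv A * cuv B / 2%:R + cvv A * cvv B.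

Definition pair_dot x y : F := bqf_dot x.1 y.1 + bqf_dot x.2 y.2.

End Forms.

Section Trace.

Variables (F : finFieldType) (p : nat) (charFp : p \in [pchar F]).

Definition Fp_galTrace (a : F) : pPrimeCharType charFp :=
  galTrace 1%VS {: pPrimeCharType charFp}%VS a.

(* The trace lies in the prime subfield; Fp_trace a is the corresponding
   element of 'F_p, that is a residue in {0, ..., p - 1}. *)
Definition Fp_trace (a : F) : 'F_p :=
  odflt 0 [pick t : 'F_p | t%:A == Fp_galTrace a].

Lemma Fp_traceE (a : F) : (Fp_trace a)%:A = Fp_galTrace a.
Proof.
rewrite /Fp_trace; case: pickP => [t /eqP //|notr].
have /vlineP[t def_t] : Fp_galTrace a \in 1%VS.
  by apply: mem_galTrace; [apply: finField_galois; apply: sub1v | apply: memvf].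
by have := notr t; rewrite def_t eqxx.
Qed.

End Trace.

Section Fourier.

Variable R : realType.

(* exp (x + i y) = e^x (cos y + i sin y). *)
Definition cexp (z : R[i]) : R[i] :=
  ((expR (complex.Re z))%:C * (cos (complex.Im z) +i* sin (complex.Im z)))%C.

Variables (F : finFieldType) (p : nat) (charFp : p \in [pchar F]).

Definition fourier (phi : bqf_pair F -> R[i]) (y : bqf_pair F) : R[i] :=
  #|F|%:R ^- 6 *
  \sum_(x : bqf_pair F)
    phi x * cexp (2%:R * (pi%:C)%C * ('i)%C
                  * (nat_of_ord (Fp_trace charFp (pair_dot x y)))%:R / p%:R).

Definition indic (l : F) (i : 'I_7) (x : bqf_pair F) : R[i] :=
  (x \in calO l i)%:R.

Definition is_fourier_matrix (l : F) (M : 'M[R[i]]_7) : Prop :=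
  forall (j : 'I_7) (y : bqf_pair F),
    fourier (indic l j) y = \sum_(i < 7) M i j * indic l i y.

End Fourier.

Definition table_rows (K : fieldType) (q : K) : seq (seq K) :=
  [:: [:: 1;
          (q - 1) * (q + 1) ^+ 2;
          (q - 1) * (q + 1) ^+ 2 * q / 2%:R;
          (q - 1) ^+ 2 * q * (q + 1) / 2%:R;
          (q + 1) ^+ 2 * q * (q - 1) ^+ 2;
          (q + 1) ^+ 2 * q ^+ 2 * (q - 1) ^+ 2 / 2%:R;
          (q - 1) ^+ 3 * q ^+ 2 * (q + 1) / 2%:R];
      [:: 1;
          q ^+ 2 - q - 1;
          q * (2%:R * q + 1) * (q - 1) / 2%:R;
          - (q * (q - 1) / 2%:R);
          (q ^+ 2 - q - 1) * q * (q - 1);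
          - (q ^+ 2 * (q - 1) * (q + 1) / 2%:R);
          - (q ^+ 2 * (q - 1) ^+ 2 / 2%:R)];
      [:: 1;
          (2%:R * q + 1) * (q - 1);
          q * (q ^+ 2 - 2%:R * q - 1) / 2%:R;
          q * (q - 1) ^+ 2 / 2%:R;
          - ((q - 1) * (q + 1) * q);
          q ^+ 2 * (q - 1) ^+ 2 / 2%:R;
          - (q ^+ 2 * (q - 1) ^+ 2 / 2%:R)];
      [:: 1;
          - q - 1;
          (q - 1) * (q + 1) * q / 2%:R;
          (q ^+ 2 + 1) * q / 2%:R;
          - ((q - 1) * (q + 1) * q);
          - (q ^+ 2 * (q - 1) * (q + 1) / 2%:R);
          q ^+ 2 * (q - 1) * (q + 1) / 2%:R];
      [:: 1;
          q ^+ 2 - q - 1;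
          - ((q + 1) * q / 2%:R);
          - (q * (q - 1) / 2%:R);
          q;
          - (q ^+ 2 * (q - 1) / 2%:R);
          q ^+ 2 * (q - 1) / 2%:R];
      [:: 1;
          - q - 1;
          q * (q - 1) / 2%:R;
          - (q * (q - 1) / 2%:R);
          - (q * (q - 1));
          q ^+ 2;
          0];
      [:: 1;
          - q - 1;
          - ((q + 1) * q / 2%:R);
          (q + 1) * q / 2%:R;
          (q + 1) * q;
          0;
          - q ^+ 2]].

Definition table (K : fieldType) (q : K) : 'M[K]_7 :=
  \matrix_(i, j) nth 0 (nth [::] (table_rows q) i) j.

(* Main.v *)
Require Import Defs.
From HB Require Import structures.
From mathcomp Require Import all_boot all_order all_fingroup all_algebra all_field.
From mathcomp Require Import complex reals sequences exp trigo.
From mathcomp Require Import ring.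

(** A nonzero binary quadratic form is determined, up to scalars and invertible
    substitutions, by its type: its discriminant is zero, a nonzero square or a
    nonsquare. A pair of forms is either zero, or a pair (s A, t A) of
    multiples of a single form A, or spans a plane, which is then the
    orthogonal complement of a form C that is unique up to scalars. The six
    nonzero orbits are thus indexed by the type of A and by the type of C.

    For a weight w on forms, let ray_sum w x be the weighted number of ways of
    writing x as (s C, t C), and perp_sum w x the weighted number of forms C
    orthogonal to both components of x. Orthogonality of characters makes these
    two constructions dual to each other: up to powers of q, the Fourier
    transform exchanges them (ftrans_ray and ftrans_perp). When w is the
    indicator of a type, both functions are invariant under the group. Together
    with the indicator of zero, they give seven invariant functions from which
    the indicators of the orbits are obtained by solving a triangular system
    (line_fun and plane_fun). No exponential sum has to be evaluated beyond the
    orthogonality relations: the table only involves the number of forms of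
    each type, and the number of forms of one type orthogonal to a given form
    of another type.

    To count, the indicators of the three types are written as combinations of
    three functions of the discriminant d: the constant 1, the indicator of
    d = 0, and the number of square roots of d. The sums of these three are
    elementary.

    That the orbits are disjoint comes for free: the solution orbit_fun j of the
    triangular system is an invariant function that takes the value 1 at the
    j-th representative and 0 at the other ones. That they cover the whole space
    follows from normal forms of single forms: those of A directly, and those of
    C after passing to orthogonal complements. *)

Set Implicit Arguments.
Unset Strict Implicit.
Unset Printing Implicit Defensive.

Import Order.TTheory GRing.Theory Num.Theory.
Local Open Scope ring_scope.

(** * The additive character given by the trace *)

Section Trace.

Variables (F : finFieldType) (p : nat) (charFp : p \in [pchar F]).

Lemma Fp_traceD : {morph Fp_trace charFp : a b / a + b}.
Proof.
move=> a b; apply: (@fmorph_inj _ _ (in_alg (pPrimeCharType charFp))) => /=.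
by rewrite scalerDl !Fp_traceE /Fp_galTrace raddfD.
Qed.

(** The sum of all the automorphisms is not the zero map, by Dedekind's
    independence of characters. *)
Lemma Fp_trace_neq0 : exists a, Fp_trace charFp a != 0.
Proof.
have [a _ nz_a] := @gal_independent_contra _ _ {: pPrimeCharType charFp}
  [in 'Gal({: pPrimeCharType charFp} / 1)%g] (fun=> 1) 1%g (group1 _)
  (oner_neq0 _).
exists a; apply: contra nz_a => /eqP tr0.
rewrite (eq_bigr (fun y => (y : gal_of _) a)) => [|y _]; last by rewrite mul1r.
by have := Fp_traceE charFp a; rewrite tr0 scale0r => /esym/eqP.
Qed.

End Trace.

Section Characters.

Variable R : realType.

Lemma cexpD : {morph @cexp R : z w / z + w >-> z * w}.
Proof.
move=> [a b] [c d]; rewrite /cexp /= expRD cosD sinD.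
by apply/eqP; rewrite eq_complex /=; apply/andP; split; apply/eqP; ring.
Qed.

Lemma cexp0 : cexp 0 = 1 :> R[i].
Proof. by rewrite /cexp /= expR0 cos0 sin0 mul1r. Qed.

Lemma cexpMn (z : R[i]) n : cexp (z *+ n) = cexp z ^+ n.
Proof.
elim: n => [|n IHn]; first by rewrite mulr0n cexp0 expr0.
by rewrite mulrS cexpD IHn exprS.
Qed.

Definition unity_root (p : nat) : R[i] :=
  cexp (2%:R * (pi%:C)%C * ('i)%C / p%:R).

Lemma unity_root_arg p :
  2%:R * (pi%:C)%C * ('i)%C / p%:R = (0 +i* (pi *+ 2 / p%:R))%C :> R[i].
Proof.
have ->: p%:R = (p%:R%:C)%C :> R[i] by rewrite rmorph_nat.
have ->: 2%:R = (2%:R%:C)%C :> R[i] by rewrite rmorph_nat.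
rewrite -fmorphV; apply/eqP; rewrite eq_complex /= -mulr_natl.
by apply/andP; split; apply/eqP; ring.
Qed.

Lemma unity_root_exp p : (0 < p)%N -> unity_root p ^+ p = 1.
Proof.
move=> p_gt0; rewrite -cexpMn unity_root_arg -[X in cexp X]mulr_natl.
have ->: p%:R = (p%:R%:C)%C :> R[i] by rewrite rmorph_nat.
have ->: (p%:R%:C * (0 +i* (pi *+ 2 / p%:R)))%C = (0 +i* (pi *+ 2))%C :> R[i].
  apply/eqP; rewrite eq_complex /= !mul0r !mulr0 subr0 addr0 eqxx /=.
  by rewrite mulrC divfK // pnatr_eq0 -lt0n.
by rewrite /cexp /= cos2pi sin2pi expR0 mul1r.
Qed.

(** Since p > 2, the argument 2 pi / p lies strictly between 0 and pi, where the
    cosine is injective. *)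
Lemma unity_root_neq1 p : (1 < p)%N -> p <> 2%N -> unity_root p != 1.
Proof.
move=> p_gt1 p_neq2; have p_gt2 : (2 < p)%N by case: p p_gt1 p_neq2 => [|[|[]]].
rewrite /unity_root unity_root_arg /cexp /= expR0 mul1r eq_complex /=.
have p0 : (0 : R) < p%:R by rewrite ltr0n ltnW // ltnW.
have pi0 := pi_gt0 R.
have th0 : 0 < pi *+ 2 / p%:R :> R by rewrite divr_gt0 // pmulrn_lgt0.
have thpi : pi *+ 2 / p%:R < pi :> R.
  by rewrite ltr_pdivrMr // -[X in X < _]mulr_natr ltr_pM2l // ltr_nat.
rewrite negb_and; apply/orP; left; apply/eqP => cos1.
suff eq0 : pi *+ 2 / p%:R = 0 :> R by rewrite eq0 ltxx in th0.
by apply: cos_inj; rewrite ?cos0 // in_itv /= ?lexx !ltW.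
Qed.

End Characters.

Section AdditiveCharacter.

Variables (R : realType) (F : finFieldType) (p : nat) (charFp : p \in [pchar F]).

Definition addchar (a : F) : R[i] :=
  cexp (2%:R * (pi%:C)%C * ('i)%C * (nat_of_ord (Fp_trace charFp a))%:R / p%:R).

Let p_prime : prime p := pcharf_prime charFp.

Lemma addcharE a : addchar a = unity_root R p ^+ Fp_trace charFp a.
Proof.
rewrite /addchar /unity_root -cexpMn -[X in _ = cexp X]mulr_natr.
by congr cexp; rewrite mulrAC.
Qed.

(** Adding residues modulo p may drop a multiple of p, which does not matter in
    the exponent of a p-th root of unity. *)
Lemma addcharD : {morph addchar : a b / a + b >-> a * b}.
Proof.
move=> a b; rewrite !addcharE Fp_traceD -exprD.
rewrite -[in RHS](expr_mod _ (unity_root_exp R (prime_gt0 p_prime))) /=.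
by congr (_ ^+ (_ %% _)%N); apply: Fp_cast.
Qed.

Lemma addchar0 : addchar 0 = 1.
Proof.
rewrite addcharE; have ->: Fp_trace charFp 0 = 0; last exact: expr0.
by apply: (addrI (Fp_trace charFp 0)); rewrite -Fp_traceD !addr0.
Qed.

(** A nonzero residue k is prime to p, so if the k-th power of the root of unity
    were 1, then so would be the root itself. *)
Lemma addchar_neq1 : p <> 2%N -> exists a, addchar a != 1.
Proof.
move=> p_neq2; have [a tr_a] := Fp_trace_neq0 charFp; exists a.
have p_gt1 := prime_gt1 p_prime.
apply: contra (unity_root_neq1 R p_gt1 p_neq2); rewrite addcharE => /eqP z1.
set k := nat_of_ord _ in z1.
have k_gt0 : (0 < k)%N by rewrite lt0n; apply: contra tr_a.
have k_lt : (k < p)%N by rewrite /k -[X in (_ < X)%N](Fp_cast p_prime).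
have copr : coprime k p.
  by rewrite coprime_sym prime_coprime // gtnNdvd.
case: (egcdnP p k_gt0) => u v Duv _; move: copr => /eqP copr.
rewrite -(expr1 (unity_root R p)) -copr.
have: unity_root R p ^+ (u * k) = 1 by rewrite mulnC exprM z1 expr1n.
by rewrite Duv exprD mulnC exprM unity_root_exp ?prime_gt0 // expr1n mul1r => ->.
Qed.

End AdditiveCharacter.

(** * The action in coordinates *)

Section Forms.

Variable F : finFieldType.
Implicit Types (A B C : bqf F) (x y z : bqf_pair F) (g h : 'M[F]_2).

Definition bzero : bqf F := mkbqf 0 0 0.
Definition bscale (t : F) A : bqf F :=
  mkbqf (t * cuu A) (t * cuv A) (t * cvv A).
Definition bcomb (s t : F) A B : bqf F :=
  mkbqf (s * cuu A + t * cuu B) (s * cuv A + t * cuv B) (s * cvv A + t * cvv B).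
Definition disc A : F := cuv A ^+ 2 - 4%:R * cuu A * cvv A.

(** The form whose matrix is g S g^T, where S is the matrix of A: the variables
    u and v are replaced by g00 u + g10 v and g01 u + g11 v. *)
Definition bact g A : bqf F :=
  mkbqf (cuu A * g 0 0 ^+ 2 + cuv A * g 0 0 * g 0 1 + cvv A * g 0 1 ^+ 2)
        (2%:R * cuu A * g 0 0 * g 1 0 + cuv A * (g 0 0 * g 1 1 + g 0 1 * g 1 0)
         + 2%:R * cvv A * g 0 1 * g 1 1)
        (cuu A * g 1 0 ^+ 2 + cuv A * g 1 0 * g 1 1 + cvv A * g 1 1 ^+ 2).

Definition ray (s t : F) A : bqf_pair F := (bscale s A, bscale t A).

Lemma bqfP A B : cuu A = cuu B -> cuv A = cuv B -> cvv A = cvv B -> A = B.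
Proof.
case: A B => [[a b] c] [[a' b'] c']; rewrite /cuu /cuv /cvv /=.
by move=> -> -> ->.
Qed.

Lemma det2 g : \det g = g 0 0 * g 1 1 - g 0 1 * g 1 0.
Proof.
rewrite (expand_det_row _ 0) !big_ord_recl big_ord0 addr0 /cofactor !det_mx11.
rewrite !mxE /= expr0 expr1 mul1r mulN1r mulrN.
by congr (_ * g _ _ - g _ _ * g _ _); apply/val_inj.
Qed.

Lemma mulmx2E g h i j : (g *m h) i j = g i 0 * h 0 j + g i 1 * h 1 j.
Proof.
rewrite mxE !big_ord_recl big_ord0 addr0.
by congr (_ * _ + g _ _ * h _ _); apply/val_inj.
Qed.

Lemma bactM g h A : bact (g *m h) A = bact g (bact h A).
Proof. by apply: bqfP; rewrite /bact /= /cuu /cuv /cvv /= !mulmx2E; ring. Qed.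

Lemma bact1 A : bact 1%:M A = A.
Proof. by apply: bqfP; rewrite /bact /= /cuu /cuv /cvv /= !mxE /=; ring. Qed.

Lemma bact_comb g s t A B :
  bact g (bcomb s t A B) = bcomb s t (bact g A) (bact g B).
Proof. by apply: bqfP; rewrite /bact /bcomb /= /cuu /cuv /cvv /=; ring. Qed.

Lemma bact_scale g t A : bact g (bscale t A) = bscale t (bact g A).
Proof. by apply: bqfP; rewrite /bact /bscale /= /cuu /cuv /cvv /=; ring. Qed.

Lemma bact0 g : bact g bzero = bzero.
Proof. by apply: bqfP; rewrite /bact /= /cuu /cuv /cvv /=; ring. Qed.

Lemma bactK g : g \in unitmx -> cancel (bact g) (bact (invmx g)).
Proof. by move=> Ug A; rewrite -bactM mulVmx // bact1. Qed.

Lemma disc_act g A : disc (bact g A) = \det g ^+ 2 * disc A.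
Proof. by rewrite det2 /disc /bact /= /cuu /cuv /cvv /=; ring. Qed.

Lemma disc_scale t A : disc (bscale t A) = t ^+ 2 * disc A.
Proof. by rewrite /disc /bscale /= /cuu /cuv /cvv /=; ring. Qed.

Lemma bqf_dotC A B : bqf_dot A B = bqf_dot B A.
Proof. by rewrite /bqf_dot [cuu _ * _]mulrC [cuv _ * _]mulrC [cvv _ * _]mulrC. Qed.

Lemma bqf_dot_comb s t A B C :
  bqf_dot (bcomb s t A B) C = s * bqf_dot A C + t * bqf_dot B C.
Proof. by rewrite /bqf_dot /bcomb /= /cuu /cuv /cvv /=; ring. Qed.

Lemma bqf_dot_scale t A C : bqf_dot (bscale t A) C = t * bqf_dot A C.
Proof. by rewrite /bqf_dot /bscale /= /cuu /cuv /cvv /=; ring. Qed.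

(** The pairing is the trace of the product of the two symmetric matrices, so the
    adjoint of the substitution by g is the substitution by its transpose. *)
Lemma bqf_dot_act g A C (two0 : 2%:R != 0 :> F) :
  bqf_dot (bact g A) C = bqf_dot A (bact g^T C).
Proof. by rewrite /bqf_dot /bact /= /cuu /cuv /cvv /= !mxE; field. Qed.

Lemma bcomb_scale s t a b A :
  bcomb s t (bscale a A) (bscale b A) = bscale (s * a + t * b) A.
Proof. by apply: bqfP; rewrite /bcomb /bscale /= /cuu /cuv /cvv /=; ring. Qed.

Lemma bcomb_comb s t a b c d A B :
  bcomb s t (bcomb a b A B) (bcomb c d A B) =
  bcomb (s * a + t * c) (s * b + t * d) A B.
Proof. by apply: bqfP; rewrite /bcomb /= /cuu /cuv /cvv /=; ring. Qed.

Lemma bscale0 A : bscale 0 A = bzero.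
Proof. by apply: bqfP; rewrite /bscale /= /cuu /cuv /cvv /= mul0r. Qed.

Lemma bscale1 A : bscale 1 A = A.
Proof. by apply: bqfP; rewrite /bscale /= /cuu /cuv /cvv /= mul1r. Qed.

Lemma bscaleA s t A : bscale s (bscale t A) = bscale (s * t) A.
Proof. by apply: bqfP; rewrite /bscale /= /cuu /cuv /cvv /= mulrA. Qed.

Lemma bscale_zero t : bscale t bzero = bzero.
Proof. by apply: bqfP; rewrite /bscale /= /cuu /cuv /cvv /= mulr0. Qed.

Lemma bscale_eq0 t A : (bscale t A == bzero) = (t == 0) || (A == bzero).
Proof.
apply/eqP/orP => [tA0|[/eqP->|/eqP->]]; rewrite ?bscale0 ?bscale_zero //.
have [t0|t_neq0] := eqVneq t 0; [by left | right].
by rewrite -(bscale1 A) -(mulVf t_neq0) -bscaleA tA0 bscale_zero.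
Qed.

Definition pair_act (g1 g2 : 'M[F]_2) x : bqf_pair F :=
  (bcomb (g1 0 0) (g1 0 1) (bact g2 x.1) (bact g2 x.2),
   bcomb (g1 1 0) (g1 1 1) (bact g2 x.1) (bact g2 x.2)).

Lemma pair_actM g1 g2 h1 h2 x :
  pair_act (g1 *m h1) (g2 *m h2) x = pair_act g1 g2 (pair_act h1 h2 x).
Proof.
by rewrite /pair_act /= !bact_comb !bcomb_comb !mulmx2E !bactM.
Qed.

Lemma bcomb10 A B : bcomb 1 0 A B = A.
Proof. by apply: bqfP; rewrite /bcomb /= /cuu /cuv /cvv /=; ring. Qed.

Lemma bcomb01 A B : bcomb 0 1 A B = B.
Proof. by apply: bqfP; rewrite /bcomb /= /cuu /cuv /cvv /=; ring. Qed.

Lemma pair_act1 x : pair_act 1%:M 1%:M x = x.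
Proof.
by case: x => A B; rewrite /pair_act /= !bact1 !mxE /= bcomb10 bcomb01.
Qed.

(** This turns the action, given by products of matrices, into polynomial formulas
    in the coefficients, so that later identities are checked by ring. *)
Lemma mx_bqf_lin (two0 : 2%:R != 0 :> F) s t g A B :
  mx_bqf (s *: (g *m bqf_mx A *m g^T) + t *: (g *m bqf_mx B *m g^T)) =
  bcomb s t (bact g A) (bact g B).
Proof.
have congE (C : bqf F) i j : (g *m bqf_mx C *m g^T) i j =
    cuu C * g i 0 * g j 0 + cuv C / 2%:R * (g i 0 * g j 1 + g i 1 * g j 0)
    + cvv C * g i 1 * g j 1.
  by rewrite !mulmx2E !mxE /=; ring.
rewrite /mx_bqf; move: (congE A) (congE B).
move: (g *m bqf_mx A *m g^T) (g *m bqf_mx B *m g^T) => MA MB EA EB.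
case: A B EA EB => [[a b] c] [[a1 b1] c1] EA EB.
by apply: bqfP; rewrite /bact /= /cuu /cuv /cvv /= !mxE !EA !EB /cuu /cuv /cvv /=; field.
Qed.

Lemma actE (two0 : 2%:R != 0 :> F) (k : {'GL_2[F]} * {'GL_2[F]}) x :
  Defs.act k x = pair_act (GLval k.1) (GLval k.2) x.
Proof.
by rewrite /Defs.act !mx_bqf_lin.
Qed.

Lemma in_orbitP (two0 : 2%:R != 0 :> F) x y :
  reflect (exists g1 g2,
             [/\ g1 \in unitmx, g2 \in unitmx & y = pair_act g1 g2 x])
          (y \in orbitG x).
Proof.
apply: (iffP imsetP) => [[g _ ->]|[g1 [g2 [U1 U2 ->]]]].
  exists (GLval g.1), (GLval g.2); rewrite -actE //.
  by split=> //; [apply: (GL_unitmx g.1) | apply: (GL_unitmx g.2)].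
by exists (FinRing.Unit U1, FinRing.Unit U2); rewrite // actE.
Qed.

End Forms.

(** * Fourier duality between lines and orthogonal complements *)

Section Duality.

Variables (F : finFieldType) (K : numFieldType) (psi : F -> K).
Hypothesis psiD : {morph psi : a b / a + b >-> a * b}.
Hypothesis psi0 : psi 0 = 1.
Hypothesis psi_neq1 : exists a, psi a != 1.
Hypothesis two0 : 2%:R != 0 :> F.

Implicit Types (w : bqf F -> K) (x y z : bqf_pair F).

Let q : K := #|F|%:R.

Lemma sum_psi (a : F) : \sum_t psi (t * a) = q * (a == 0)%:R.
Proof.
have [->|a_neq0] := eqVneq a 0.
  rewrite (eq_bigr (fun=> 1)) => [|t _]; last by rewrite mulr0 psi0.
  by rewrite sumr_const mulr1.
rewrite mulr0; have [b psib] := psi_neq1.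
have bij : bijective (fun t : F => t / a).
  by exists (fun t => t * a) => t; rewrite ?divfK ?mulfK.
rewrite (reindex _ (onW_bij _ bij)) /=.
under eq_bigr do rewrite divfK //.
apply/eqP; have: (psi b - 1) * \sum_t psi t == 0.
  rewrite mulrBl mul1r mulr_sumr subr_eq0.
  under eq_bigr do rewrite -psiD.
  by rewrite [X in _ == X](reindex_inj (addrI b)).
by rewrite mulf_eq0 subr_eq0 (negPf psib).
Qed.

Lemma sum_bqf (G : bqf F -> K) :
  \sum_A G A = \sum_a \sum_b \sum_c G (mkbqf a b c).
Proof.
rewrite pair_bigA pair_bigA /=; apply: eq_bigr => -[[a b] c] _ //.
Qed.

Lemma sum_bqf_psi A B :
  \sum_C psi (bqf_dot C A - bqf_dot C B) = q ^+ 3 * (A == B)%:R.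
Proof.
rewrite sum_bqf.
have dotE a b c : psi (bqf_dot (mkbqf a b c) A - bqf_dot (mkbqf a b c) B) =
    psi (a * (cuu A - cuu B)) * (psi (b * ((cuv A - cuv B) / 2%:R))
      * psi (c * (cvv A - cvv B))).
  by rewrite -!psiD /bqf_dot /=; congr psi; rewrite /cuu /cuv /cvv /=; field.
under eq_bigr => a _ do under eq_bigr => b _ do
  (under eq_bigr => c _ do rewrite dotE; rewrite -mulr_sumr -mulr_sumr).
under eq_bigr => a _ do rewrite -mulr_sumr -mulr_suml.
rewrite -mulr_suml !sum_psi mulf_eq0 invr_eq0 (negPf two0) orbF !subr_eq0.
have ->: (A == B) = [&& cuu A == cuu B, cuv A == cuv B & cvv A == cvv B].
  apply/eqP/and3P => [->|[/eqP ? /eqP ? /eqP ?]]; first by rewrite !eqxx.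
  exact: bqfP.
by rewrite -!mulnb !natrM; ring.
Qed.

Lemma sum_pair_psi y z :
  \sum_x psi (pair_dot x y - pair_dot x z) = q ^+ 6 * (y == z)%:R.
Proof.
have ->: \sum_x psi (pair_dot x y - pair_dot x z) =
    \sum_A \sum_B psi (bqf_dot A y.1 - bqf_dot A z.1) *
                  psi (bqf_dot B y.2 - bqf_dot B z.2).
  rewrite pair_bigA /=; apply: eq_bigr => -[A B] _; rewrite -psiD /pair_dot /=.
  by congr psi; ring.
under eq_bigr do rewrite -mulr_sumr.
rewrite -mulr_suml !sum_bqf_psi -[in RHS]pair_eqE /= /pair_eq -mulnb natrM.
by ring.
Qed.

Definition perp_sum w x : K :=
  \sum_C w C * ((bqf_dot x.1 C == 0) && (bqf_dot x.2 C == 0))%:R.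

Definition ray_sum w x : K := \sum_C w C * \sum_s \sum_t (x == ray s t C)%:R.

Definition ftrans (phi : bqf_pair F -> K) y : K :=
  \sum_x phi x * psi (pair_dot x y).

Lemma pair_dotC x y : pair_dot x y = pair_dot y x.
Proof. by rewrite /pair_dot bqf_dotC [bqf_dot x.2 _]bqf_dotC. Qed.

Lemma pair_dot_ray s t C y :
  pair_dot (ray s t C) y = s * bqf_dot y.1 C + t * bqf_dot y.2 C.
Proof.
by rewrite /pair_dot !bqf_dot_scale [bqf_dot C _]bqf_dotC [bqf_dot C _]bqf_dotC.
Qed.

(** The pairs (s C, t C) form a subgroup, whose annihilator consists of the pairs
    orthogonal to C. *)
Lemma sum_ray_psi C y :
  \sum_s \sum_t psi (pair_dot (ray s t C) y) =
  q ^+ 2 * ((bqf_dot y.1 C == 0) && (bqf_dot y.2 C == 0))%:R.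
Proof.
under eq_bigr => s _ do (under eq_bigr => t _ do rewrite pair_dot_ray psiD;
  rewrite -mulr_sumr).
by rewrite -mulr_suml !sum_psi -mulnb natrM; ring.
Qed.

Lemma ftrans_ray w y : ftrans (ray_sum w) y = q ^+ 2 * perp_sum w y.
Proof.
rewrite /ftrans /ray_sum /perp_sum mulr_sumr.
under eq_bigr => x _ do rewrite mulr_suml.
rewrite exchange_big; apply: eq_bigr => C _ /=.
rewrite mulrCA -sum_ray_psi.
under eq_bigr => x _ do rewrite -mulrA mulr_suml.
rewrite -mulr_sumr; congr (_ * _); rewrite exchange_big; apply: eq_bigr => s _ /=.
under eq_bigr => x _ do rewrite mulr_suml.
rewrite exchange_big; apply: eq_bigr => t _ /=.
rewrite (bigD1 (ray s t C)) //= eqxx mul1r big1 ?addr0 // => x /negPf->.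
by rewrite mul0r.
Qed.

Lemma q_neq0 : q != 0.
Proof. by rewrite pnatr_eq0 -lt0n; apply/card_gt0P; exists 0. Qed.

(** By sum_ray_psi, being orthogonal to C is an average of characters; the
    orthogonality relation on the space of pairs then only keeps the terms for
    which y is a pair of multiples of C. *)
Lemma ftrans_perp w y : ftrans (perp_sum w) y = q ^+ 4 * ray_sum w y.
Proof.
apply: (mulfI (expf_neq0 2 q_neq0)).
rewrite mulrA -exprD /ftrans /perp_sum /ray_sum !mulr_sumr.
under eq_bigr => x _ do rewrite mulr_suml mulr_sumr.
rewrite exchange_big; apply: eq_bigr => C _ /=.
rewrite mulrCA.
under eq_bigr => x _ do rewrite -mulrA mulrCA (mulrA (q ^+ 2)) -sum_ray_psi mulr_suml.
rewrite -mulr_sumr; congr (_ * _).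
(* The relation y = - (s C, t C) that arises is turned into y = (s C, t C) by
   changing the signs of s and t. *)
rewrite exchange_big mulr_sumr [in RHS](reindex_inj oppr_inj).
apply: eq_bigr => s _ /=.
under eq_bigr => x _ do rewrite mulr_suml.
rewrite exchange_big mulr_sumr.
rewrite [in RHS](reindex_inj oppr_inj); apply: eq_bigr => t _ /=.
rewrite -sum_pair_psi; apply: eq_bigr => x _.
rewrite -psiD [in RHS]pair_dotC -[in RHS](pair_dotC (ray _ _ _)) !pair_dot_ray.
by rewrite pair_dotC; congr psi; ring.
Qed.

Lemma ftrans_zero y : ftrans (fun x => (x == (bzero F, bzero F))%:R) y = 1.
Proof.
rewrite /ftrans (bigD1 (bzero F, bzero F)) //= eqxx mul1r big1.
  rewrite /pair_dot /bqf_dot /= !mul0r !addr0 psi0 //.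
by move=> x /negPf->; rewrite mul0r.
Qed.

End Duality.

(** * Invariance under the group *)

Section Invariance.

Variables (F : finFieldType) (K : numFieldType).
Hypothesis two0 : 2%:R != 0 :> F.

Implicit Types (x : bqf_pair F) (g : 'M[F]_2).

Lemma unitmx2_eq0 g a b : g \in unitmx ->
  (g 0 0 * a + g 0 1 * b == 0) && (g 1 0 * a + g 1 1 * b == 0) =
  (a == 0) && (b == 0).
Proof.
rewrite unitmxE det2 unitfE => det_neq0.
apply/andP/andP => [[/eqP ab0 /eqP ab1]|[/eqP-> /eqP->]]; last first.
  by rewrite !mulr0 addr0.
split.
  rewrite -(mulrI_eq0 _ (lregP det_neq0)); apply/eqP.
  transitivity (g 1 1 * (g 0 0 * a + g 0 1 * b)
                - g 0 1 * (g 1 0 * a + g 1 1 * b)); first by ring.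
  by rewrite ab0 ab1; ring.
rewrite -(mulrI_eq0 _ (lregP det_neq0)); apply/eqP.
transitivity (g 0 0 * (g 1 0 * a + g 1 1 * b)
              - g 1 0 * (g 0 0 * a + g 0 1 * b)); first by ring.
by rewrite ab0 ab1; ring.
Qed.

Lemma pair_actK g1 g2 : g1 \in unitmx -> g2 \in unitmx ->
  cancel (pair_act g1 g2) (pair_act (invmx g1) (invmx g2)).
Proof. by move=> U1 U2 x; rewrite -pair_actM !mulVmx // pair_act1. Qed.

Variable w : bqf F -> K.
Hypothesis w_act : forall g C, g \in unitmx -> w (bact g C) = w C.

(** By adjunction, C is orthogonal to the transformed pair if and only if its
    transform by the transpose of g2 is orthogonal to the original one. *)
Lemma perp_sum_act g1 g2 x : g1 \in unitmx -> g2 \in unitmx ->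
  perp_sum w (pair_act g1 g2 x) = perp_sum w x.
Proof.
move=> U1 U2; have U2T : g2^T \in unitmx by rewrite unitmx_tr.
rewrite /perp_sum [RHS](reindex_inj (can_inj (bactK U2T))).
apply: eq_bigr => C _; rewrite w_act //=.
by rewrite !bqf_dot_comb unitmx2_eq0 // !bqf_dot_act.
Qed.

Lemma ray_sum_act g1 g2 x : g1 \in unitmx -> g2 \in unitmx ->
  ray_sum w (pair_act g1 g2 x) = ray_sum w x.
Proof.
move=> U1 U2; rewrite /ray_sum (reindex_inj (can_inj (bactK U2))).
apply: eq_bigr => C _; rewrite w_act //=; congr (_ * _).
pose h (st : F * F) :=
  (g1 0 0 * st.1 + g1 0 1 * st.2, g1 1 0 * st.1 + g1 1 1 * st.2).
have h_inj : injective h.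
  move=> [s t] [s' t'] [/eqP e0 /eqP e1].
  have: (s - s' == 0) && (t - t' == 0).
    rewrite -(unitmx2_eq0 _ _ U1) !mulrBr [_ - _ + _]addrACA.
    rewrite [in X in _ && X]addrACA -!opprD !subr_eq0.
    exact/andP.
  by rewrite !subr_eq0 => /andP[/eqP-> /eqP->].
rewrite !pair_bigA /= (reindex_inj h_inj); apply: eq_bigr => -[s t] _ /=.
have ->: ray (g1 0 0 * s + g1 0 1 * t) (g1 1 0 * s + g1 1 1 * t) (bact g2 C) =
    pair_act g1 g2 (ray s t C).
  by rewrite /pair_act /ray /= !bact_scale !bcomb_scale.
by rewrite (can_eq (pair_actK U1 U2)).
Qed.

End Invariance.

(** * Counting square roots *)

Section SquareRoots.

Variables (F : finFieldType) (K : numFieldType).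
Hypothesis two0 : 2%:R != 0 :> F.

Let q : K := #|F|%:R.

Definition nroots (d : F) : K := \sum_s (s ^+ 2 == d)%:R.

Lemma sum_pick (G : F -> K) a : \sum_s G s * (s == a)%:R = G a.
Proof.
rewrite (bigD1 a) //= eqxx mulr1 big1 ?addr0 // => s /negPf->.
by rewrite mulr0.
Qed.

Lemma sum_pick1 (a : F) : \sum_s (s == a)%:R = 1 :> K.
Proof.
by rewrite -[RHS](sum_pick (fun=> 1) a); apply: eq_bigr => s _; rewrite mul1r.
Qed.

Lemma sum_cst (a : K) : \sum_(s : F) a = q * a.
Proof. by rewrite sumr_const mulr_natl. Qed.

Lemma sum_shift (f : F -> K) a b : a != 0 -> \sum_c f (b + a * c) = \sum_d f d.
Proof.
move=> a_neq0; have inj : injective (fun c => b + a * c).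
  by move=> c c' /addrI/(mulfI a_neq0).
by rewrite [RHS](reindex_inj inj).
Qed.

Lemma nroots0 : nroots 0 = 1.
Proof.
by rewrite -[RHS](sum_pick1 0); apply: eq_bigr => s _; rewrite sqrf_eq0.
Qed.

Lemma nroots_sqr e : e != 0 -> nroots (e ^+ 2) = 2%:R.
Proof.
move=> e_neq0; rewrite /nroots -[RHS]/(1 + 1) -[X in X + _](sum_pick1 e).
rewrite -[X in _ + X](sum_pick1 (- e)) -big_split; apply: eq_bigr => s _ /=.
rewrite eqf_sqr; have [->|//] := eqVneq s e; last by rewrite add0r.
have /negPf->: e != - e by rewrite -addr_eq0 -mulr2n -mulr_natl mulf_neq0.
by rewrite addr0.
Qed.

Lemma nroots_nonsquare d : (forall s, s ^+ 2 != d) -> nroots d = 0.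
Proof. by move=> nsq; rewrite /nroots big1 // => s _; rewrite (negPf (nsq s)). Qed.

Lemma nrootsM s d : s != 0 -> nroots (s ^+ 2 * d) = nroots d.
Proof.
move=> s_neq0; rewrite /nroots (reindex_inj (mulfI s_neq0)).
by apply: eq_bigr => t _; rewrite exprMn (inj_eq (mulfI (expf_neq0 2 s_neq0))).
Qed.

Lemma sum_nroots : \sum_d nroots d = q.
Proof.
rewrite /nroots exchange_big /= -[RHS]mulr1 -sum_cst; apply: eq_bigr => s _.
by rewrite -[RHS](sum_pick1 (s ^+ 2)); apply: eq_bigr => d _; rewrite eq_sym.
Qed.

Lemma sum_nroots_sqr : \sum_b nroots (b ^+ 2) = 2%:R * q - 1.
Proof.
rewrite (bigD1 0) //= expr0n /= nroots0.
rewrite (eq_bigr (fun=> 2%:R)) => [|b b_neq0]; last exact: nroots_sqr.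
have /eqP := sum_cst 2%:R; rewrite (bigD1 0) //= addrC eq_sym -subr_eq => /eqP <-.
by ring.
Qed.

(** Put m = b - s in b ^ 2 - s ^ 2 = k: then m (2 s + m) = k, which has exactly
    one solution s for each nonzero m, and none for m = 0. *)
Lemma sum_nroots_sub k : k != 0 -> \sum_b nroots (b ^+ 2 - k) = q - 1.
Proof.
move=> k_neq0; rewrite /nroots exchange_big /=.
under eq_bigr => s _ do rewrite (reindex_inj (addrI s)) /=.
rewrite exchange_big (bigD1 0) //= big1 ?add0r => [|s _]; last first.
  by rewrite addr0 -subr_eq0 opprB addrC subrK (negPf k_neq0).
rewrite (eq_bigr (fun=> 1)) => [|m m_neq0].
  have /eqP := sum_cst 1; rewrite mulr1 (bigD1 0) //= addrC eq_sym -subr_eq.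
  by move=> /eqP <-.
rewrite -[RHS](sum_pick1 ((k / m - m) / 2%:R)); apply: eq_bigr => s _.
congr (_%:R); congr nat_of_bool; apply/eqP/eqP => [eq_k|->]; last by field; apply/andP.
have ->: k = (s + m) ^+ 2 - s ^+ 2 by rewrite eq_k; ring.
by field; apply/andP.
Qed.

Variable l : F.
Hypothesis l_neq0 : l != 0.
Hypothesis l_nonsquare : forall s, s ^+ 2 != l.

Lemma nroots_le2 d : nroots d <= 2%:R.
Proof.
have [/existsP[s /eqP <-]|/existsPn nsq] := boolP [exists s, s ^+ 2 == d].
  have [->|s_neq0] := eqVneq s 0; last by rewrite nroots_sqr.
  by rewrite expr0n /= nroots0 ler1n.
by rewrite nroots_nonsquare // ler0n.
Qed.

(** Each left-hand side is at most 2, because d and d / l cannot both be nonzero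
    squares when l is a nonsquare. The sum of all left-hand sides is 2 q, hence
    none of them is smaller. *)
Lemma nroots_twist d : nroots d + nroots (l^-1 * d) = 2%:R.
Proof.
have ge0 : forall d, true -> 0 <= 2%:R - (nroots d + nroots (l^-1 * d)).
  move=> {}d _; rewrite subr_ge0.
  have [->|d_neq0] := eqVneq d 0; first by rewrite mulr0 nroots0 -mulr2n.
  have [/existsP[s /eqP def_d]|/existsPn nsq] := boolP [exists s, s ^+ 2 == d].
    have nsq' t : t ^+ 2 != l^-1 * d.
      apply: contra (l_nonsquare (s / t)) => /eqP t2.
      rewrite expr_div_n t2 def_d; apply/eqP; field.
      exact/andP.
    by rewrite [X in _ + X]nroots_nonsquare // addr0 nroots_le2.
  by rewrite nroots_nonsquare // add0r nroots_le2.
have sum0 : \sum_d (2%:R - (nroots d + nroots (l^-1 * d))) = 0.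
  rewrite sumrB sum_cst [X in _ - X]big_split /= sum_nroots.
  under [X in _ - (_ + X)]eq_bigr do rewrite -[_ * _]add0r.
  by rewrite sum_shift ?invr_eq0 // sum_nroots; ring.
by apply/esym/eqP; rewrite -subr_eq0; apply/eqP; apply: (psumr_eq0P ge0 sum0).
Qed.

(** The nonsquares form a single class modulo squares. *)
Lemma nonsquare_ratio d : (forall s, s ^+ 2 != d) -> exists k, d = l * k ^+ 2.
Proof.
move=> nsq; have := nroots_twist d; rewrite nroots_nonsquare // add0r => eq2.
have [/existsP[s /eqP def_s]|/existsPn nsq'] := boolP [exists s, s ^+ 2 == l^-1 * d].
  by exists s; rewrite def_s mulVKf.
by move/eqP: eq2; rewrite nroots_nonsquare // eq_sym pnatr_eq0.
Qed.

(** The terms with c = 0 are the number of roots of squares; each of the q - 1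
    others falls under sum_nroots_sub, since 4 l c ^ 2 is then nonzero. *)
Lemma sum_nroots_norm :
  \sum_b \sum_c nroots (b ^+ 2 - 4%:R * l * c ^+ 2) = q ^+ 2.
Proof.
rewrite exchange_big (bigD1 0) //=.
under eq_bigr => b _ do rewrite expr0n mulr0 subr0.
rewrite sum_nroots_sqr (eq_bigr (fun=> q - 1)) => [|c c_neq0].
  have /eqP := sum_cst (q - 1); rewrite (bigD1 0) //= addrC eq_sym -subr_eq.
  by move=> /eqP <-; ring.
apply: sum_nroots_sub; rewrite !mulf_neq0 ?expf_neq0 //.
have ->: 4%:R = 2%:R * 2%:R :> F by ring.
exact: mulf_neq0.
Qed.

End SquareRoots.

(** * Normal forms, and the orbits cover the space *)

Section Exhaustion.

Variable F : finFieldType.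
Hypothesis two0 : 2%:R != 0 :> F.
Variable l : F.
Hypothesis l_neq0 : l != 0.
Hypothesis l_nonsquare : forall s, s ^+ 2 != l.

Implicit Types (A B C : bqf F) (x y : bqf_pair F) (g : 'M[F]_2).

Definition mx2 (a b c d : F) : 'M[F]_2 :=
  \matrix_(i, j) if i == 0 then if j == 0 then a else b
                 else if j == 0 then c else d.

Lemma mx2_unit a b c d : a * d - b * c != 0 -> mx2 a b c d \in unitmx.
Proof. by move=> det_neq0; rewrite unitmxE det2 !mxE /= unitfE. Qed.

(** Equivalence under substitutions and scalars. Scalars have to be allowed
    because the first factor of the group rescales both components of a pair. *)
Definition same_type A C :=
  exists c g, [/\ c != 0, g \in unitmx & C = bscale c (bact g A)].

Lemma same_type_trans A B C : same_type A B -> same_type B C -> same_type A C.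
Proof.
move=> [c [g [c_neq0 Ug ->]]] [d [h [d_neq0 Uh ->]]].
exists (d * c), (h *m g); split; rewrite ?mulf_neq0 ?unitmx_mul ?Uh //.
by rewrite bact_scale bscaleA bactM.
Qed.

Let u2 : bqf F := mkbqf 1 0 0.
Let uv : bqf F := mkbqf 0 1 0.
Let v2 : bqf F := mkbqf 0 0 1.
Let anis : bqf F := mkbqf 1 0 (- l).

Lemma four0 : 4%:R != 0 :> F.
Proof. by have ->: 4%:R = 2%:R * 2%:R :> F by [ring]; apply: mulf_neq0. Qed.

Lemma bqf_neq0 A : A != bzero F -> [\/ cuu A != 0, cuv A != 0 | cvv A != 0].
Proof.
move=> A_neq0; apply/or3P; apply: contraR A_neq0; rewrite !negb_or !negbK.
by case/and3P=> /eqP a0 /eqP b0 /eqP c0; apply/eqP/bqfP.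
Qed.

(** When the coefficient of u^2 is nonzero, complete the square. A nonzero square
    discriminant gives two distinct linear factors, and a nonsquare one differs
    from l by a square, by nonsquare_ratio. When it is zero, v divides the form. *)
Lemma normal_form C : C != bzero F ->
  [\/ same_type v2 C, same_type uv C | same_type anis C].
Proof.
case: C => [[a b] c] /bqf_neq0; rewrite /cuu /cuv /cvv /= => nz.
have [a0|a_neq0] := eqVneq a 0.
  have [b0|b_neq0] := eqVneq b 0.
    constructor 1; exists c, 1%:M; split; rewrite ?unitmx1 //.
      by case: nz; rewrite ?a0 ?b0 ?eqxx.
    by rewrite bact1 a0 b0; apply: bqfP; rewrite /bscale /cuu /cuv /cvv /=; ring.
  constructor 2; exists 1, (mx2 0 b 1 c); split; rewrite ?oner_neq0 //.
    by apply: mx2_unit; rewrite mul0r sub0r mulr1 oppr_eq0.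
  rewrite a0; apply: bqfP;
    by rewrite /bscale /bact /cuu /cuv /cvv /= !mxE /=; ring.
pose D := b ^+ 2 - 4%:R * a * c.
have [/existsP[d /eqP def_d]|/existsPn nsq] := boolP [exists d, d ^+ 2 == D].
  have [d0|d_neq0] := eqVneq d 0.
    constructor 1; exists a, (mx2 0 1 1 (b / (2%:R * a))); split=> //.
      by apply: mx2_unit; rewrite mul0r sub0r mulr1 oppr_eq0 oner_neq0.
    have def_c : c = b ^+ 2 / (4%:R * a).
      have: b ^+ 2 - 4%:R * a * c = 0 by rewrite -/D -def_d d0 expr0n.
      by move/eqP; rewrite subr_eq0 => /eqP->; field; rewrite a_neq0 four0.
    rewrite def_c; apply: bqfP;
      by rewrite /bscale /bact /cuu /cuv /cvv /= !mxE /=; field;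
         rewrite ?a_neq0 ?two0 ?four0.
  pose r1 := (d - b) / (2%:R * a); pose r2 := (- d - b) / (2%:R * a).
  constructor 2; exists a, (mx2 1 1 (- r1) (- r2)); split=> //.
    apply: mx2_unit; have ->: 1 * - r2 - 1 * - r1 = d / a.
      by rewrite /r1 /r2; field; rewrite a_neq0 two0.
    by rewrite mulf_neq0 ?invr_eq0.
  have def_c : c = (b ^+ 2 - d ^+ 2) / (4%:R * a).
    by rewrite def_d /D; field; rewrite a_neq0 four0.
  rewrite def_c; apply: bqfP;
    by rewrite /bscale /bact /cuu /cuv /cvv /= !mxE /= /r1 /r2; field;
       rewrite ?a_neq0 ?two0 ?four0.
have [k def_D] := nonsquare_ratio rat two0 l_neq0 l_nonsquare nsq.
constructor 3; exists a, (mx2 1 0 (b / (2%:R * a)) (k / (2%:R * a))); split=> //.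
  apply: mx2_unit; rewrite mul1r mul0r subr0 !mulf_neq0 ?invr_eq0 ?mulf_neq0 //.
  by apply: contra (nsq 0) => /eqP k0; rewrite def_D k0 !expr0n mulr0.
have def_c : c = (b ^+ 2 - l * k ^+ 2) / (4%:R * a).
  by rewrite -def_D /D; field; rewrite a_neq0 four0.
rewrite def_c; apply: bqfP;
  by rewrite /bscale /bact /cuu /cuv /cvv /= !mxE /=; field;
     rewrite ?a_neq0 ?two0 ?four0.
Qed.

(** These representatives are the ones whose orthogonal complements are spanned by
    the representatives of the last three orbits. They come from those of
    normal_form by exchanging u and v. *)
Lemma normal_form_swap C : C != bzero F ->
  [\/ same_type u2 C, same_type uv C | same_type (mkbqf l 0 (- 1)) C].
Proof.
have Uw : mx2 0 1 1 0 \in unitmx.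
  by apply: mx2_unit; rewrite mul0r sub0r mulr1 oppr_eq0 oner_neq0.
case/normal_form => tC; [constructor 1 | by constructor 2 | constructor 3].
  apply: same_type_trans tC; exists 1, (mx2 0 1 1 0); rewrite oner_neq0.
  by split=> //; apply: bqfP;
    rewrite /bscale /bact /cuu /cuv /cvv /= !mxE /=; ring.
apply: same_type_trans tC; exists (- 1), (mx2 0 1 1 0).
rewrite oppr_eq0 oner_neq0.
by split=> //; apply: bqfP;
  rewrite /bscale /bact /cuu /cuv /cvv /= !mxE /=; ring.
Qed.

Definition dependent x :=
  [exists s, exists t,
     ((s != 0) || (t != 0)) && (bcomb s t x.1 x.2 == bzero F)].

Lemma dependentI s t x :
  (s != 0) || (t != 0) -> bcomb s t x.1 x.2 = bzero F -> dependent x.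
Proof.
by move=> nz /eqP comb0; apply/existsP; exists s; apply/existsP; exists t;
  rewrite nz.
Qed.

Lemma dependentE x : dependent x ->
  exists s t, (s != 0) || (t != 0) /\ bcomb s t x.1 x.2 = bzero F.
Proof.
by case/existsP=> s /existsP[t /andP[nz /eqP comb0]]; exists s, t.
Qed.

(** The form C is the cross product of the two coefficient vectors, with a factor
    2 in the middle that makes up for the 1/2 in the pairing. It vanishes only
    if the vectors are proportional. *)
Lemma perp_independent x : ~~ dependent x ->
  exists C, [/\ C != bzero F, bqf_dot x.1 C = 0 & bqf_dot x.2 C = 0].
Proof.
case: x => [[[a b] c] [[a' b'] c']].
pose C := mkbqf (b * c' - c * b') (2%:R * (c * a' - a * c')) (a * b' - b * a').
move=> indep; have [C0|C_neq0] := eqVneq C (bzero F); last first.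
  by exists C; split; rewrite // /bqf_dot /cuu /cuv /cvv /=; field.
case/negP: indep.
have [eA|/bqf_neq0 nz] := eqVneq (mkbqf a b c) (bzero F).
  apply: (@dependentI 1 0); rewrite ?oner_neq0 //=.
  by rewrite -[(a, b, c)]/(mkbqf a b c) eA bcomb10.
have := congr1 (@cuu F) C0; have := congr1 (@cuv F) C0.
have := congr1 (@cvv F) C0; rewrite /cuu /cuv /cvv /= => ab.
move/eqP; rewrite mulf_eq0 (negPf two0) => /= /eqP ca bc.
case: nz; rewrite /cuu /cuv /cvv /= => nz.
- apply: (@dependentI (- a') a); rewrite ?nz ?orbT //; apply: bqfP;
    rewrite /bcomb /cuu /cuv /cvv /=; first by ring.
    by rewrite -ab; ring.
  by rewrite -[RHS]oppr0 -ca; ring.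
- apply: (@dependentI (- b') b); rewrite ?nz ?orbT //; apply: bqfP;
    rewrite /bcomb /cuu /cuv /cvv /=; [|by ring|by rewrite -bc; ring].
  by rewrite -[RHS]oppr0 -ab; ring.
apply: (@dependentI (- c') c); rewrite ?nz ?orbT //; apply: bqfP;
  rewrite /bcomb /cuu /cuv /cvv /=; last by ring.
  by rewrite -ca; ring.
by rewrite -[RHS]oppr0 -bc; ring.
Qed.

Lemma orbit_refl x : x \in orbitG x.
Proof.
apply/(in_orbitP two0); exists 1%:M, 1%:M.
by rewrite !unitmx1 pair_act1.
Qed.

Lemma orbit_act g1 g2 x y : g1 \in unitmx -> g2 \in unitmx ->
  pair_act g1 g2 y \in orbitG x -> y \in orbitG x.
Proof.
move=> U1 U2 /(in_orbitP two0)[h1 [h2 [V1 V2 eq_yx]]]; apply/(in_orbitP two0).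
exists (invmx g1 *m h1), (invmx g2 *m h2); rewrite !unitmx_mul !unitmx_inv.
by rewrite U1 U2 V1 V2 pair_actM -eq_yx pair_actK.
Qed.

(** A row operation brings the linear relation to the first component. *)
Lemma dependent_orbit x : dependent x ->
  exists B, forall y, (bzero F, B) \in orbitG y -> x \in orbitG y.
Proof.
case/dependentE=> s [t [nz comb0]].
have [c [d det_neq0]] : exists c d, s * d - t * c != 0.
  have [s0|s_neq0] := eqVneq s 0; [exists 1, 0 | exists 0, 1].
    by move: nz; rewrite s0 eqxx /= mul0r sub0r mulr1 oppr_eq0.
  by rewrite mulr1 mulr0 subr0.
exists (bcomb c d x.1 x.2) => y yP.
apply: (orbit_act (mx2_unit det_neq0) (unitmx1 _ _)).
by rewrite /pair_act !mxE /= !bact1 comb0.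
Qed.

Lemma same_type_orbit A B : same_type A B -> (bzero F, B) \in orbitG (bzero F, A).
Proof.
case=> c [g [c_neq0 Ug ->]]; apply/(in_orbitP two0); exists (c%:M), g.
rewrite unitmxE det_scalar unitrX ?unitfE //; split=> //.
rewrite /pair_act /= !mxE /= bact0; congr (_, _); apply: bqfP;
  by rewrite /bcomb /bscale /cuu /cuv /cvv /=; ring.
Qed.

Lemma dependent_act g x : g \in unitmx ->
  dependent (pair_act 1%:M g x) -> dependent x.
Proof.
move=> Ug /dependentE[s [t [nz comb0]]]; apply: (@dependentI s t) => //.
move: comb0; rewrite /pair_act !mxE /= bcomb10 bcomb01 -bact_comb.
by move/(congr1 (bact (invmx g))); rewrite bactK // bact0.
Qed.

(** The components of x are combinations of those of y, and the matrix of the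
    coefficients is invertible because x is independent. *)
Lemma perp_orbit A y x :
    (forall B, bqf_dot B A = 0 -> exists s t, B = bcomb s t y.1 y.2) ->
    bqf_dot x.1 A = 0 -> bqf_dot x.2 A = 0 -> ~~ dependent x ->
  x \in orbitG y.
Proof.
move=> span /span[s [t def1]] /span[s' [t' def2]] indep.
apply/(in_orbitP two0); exists (mx2 s t s' t'), 1%:M; rewrite unitmx1; split=> //.
  apply: mx2_unit; apply/eqP => det0.
  have comb0 a b : a * s + b * s' = 0 -> a * t + b * t' = 0 ->
      ~~ ((a != 0) || (b != 0)).
    move=> eq_s eq_t; apply: contra indep => nz; apply: (@dependentI a b) => //.
    rewrite def1 def2 bcomb_comb eq_s eq_t; apply: bqfP;
      by rewrite /bcomb /cuu /cuv /cvv /=; ring.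
  have := comb0 t' (- t); rewrite negb_or !negbK oppr_eq0.
  case/(_ _ _)/andP => [||/eqP t'0 /eqP t0]; [by rewrite -[RHS]det0; ring | by ring |].
  have := comb0 s' (- s); rewrite negb_or !negbK oppr_eq0.
  case/(_ _ _)/andP => [||/eqP s'0 /eqP s0]; [by ring | by rewrite t0 t'0; ring |].
  have := comb0 1 0; rewrite oner_neq0 s0 t0 s'0 t'0 !mulr0 addr0.
  by move/(_ erefl erefl).
by rewrite /pair_act !mxE /= !bact1 -def1 -def2; case: (x).
Qed.

Lemma same_type_perp A B C g c : c != 0 -> g \in unitmx ->
    C = bscale c (bact g A) -> bqf_dot B C = 0 -> bqf_dot (bact g^T B) A = 0.
Proof.
move=> c_neq0 Ug ->; rewrite bqf_dotC bqf_dot_scale => /eqP.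
by rewrite mulf_eq0 (negPf c_neq0) /= bqf_dotC => /eqP;
  rewrite [bqf_dot _ A]bqf_dot_act // trmxK.
Qed.

(** For an independent pair, move the form orthogonal to it to normal form: the
    pair then spans the orthogonal complement of that normal form. *)
Lemma orbits_cover x : exists i : 'I_7, x \in calO l i.
Proof.
suff: exists2 i, (i < 7)%N &
    x \in orbitG (nth (mkbqf 0 0 0, mkbqf 0 0 0) (orbit_reps l) i).
  by case=> i lt_i xi; exists (Ordinal lt_i).
have [/dependent_orbit[B xB]|indep] := boolP (dependent x).
  have [B0|/normal_form[]tB] := eqVneq B (bzero F).
  - by exists 0%N => //; apply: xB; rewrite B0 orbit_refl.
  - by exists 1%N => //; apply: xB; apply: same_type_orbit.
  - by exists 2%N => //; apply: xB; apply: same_type_orbit.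
  by exists 3%N => //; apply: xB; apply: same_type_orbit.
have [C [/normal_form_swap tC perp1 perp2]] := perp_independent indep.
have move_perp A y : same_type A C ->
    (forall B, bqf_dot B A = 0 -> exists s t, B = bcomb s t y.1 y.2) ->
  x \in orbitG y.
  move=> [c [g [c_neq0 Ug def_C]]] span.
  have UgT : g^T \in unitmx by rewrite unitmx_tr.
  apply: (orbit_act (unitmx1 _ _) UgT); apply: (perp_orbit span).
  - by rewrite /pair_act !mxE /= bcomb10 (same_type_perp c_neq0 Ug def_C).
  - by rewrite /pair_act !mxE /= bcomb01 (same_type_perp c_neq0 Ug def_C).
  exact: contra (dependent_act UgT) indep.
case: tC => /move_perp xP.
- exists 4%N => //; apply: xP => -[[a b] c].
  rewrite /bqf_dot /cuu /cuv /cvv /= mulr1 !mulr0 mul0r !addr0 => ->.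
  by exists c, b; apply: bqfP; rewrite /bcomb /cuu /cuv /cvv /=; ring.
- exists 5%N => //; apply: xP => -[[a b] c].
  rewrite /bqf_dot /cuu /cuv /cvv /= mulr1 !mulr0 add0r addr0 => /eqP.
  rewrite mulf_eq0 invr_eq0 (negPf two0) orbF => /eqP->.
  by exists c, a; apply: bqfP; rewrite /bcomb /cuu /cuv /cvv /=; ring.
exists 6%N => //; apply: xP => -[[a b] c].
rewrite /bqf_dot /cuu /cuv /cvv /= mulr0 mul0r addr0 mulrN1 => /eqP.
rewrite subr_eq0 => /eqP <-.
by exists b, a; apply: bqfP; rewrite /bcomb /cuu /cuv /cvv /=; ring.
Qed.

End Exhaustion.

(** * Counting forms by their discriminant *)

Section WeightedCounts.

Variables (F : finFieldType) (K : numFieldType).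
Hypothesis two0 : 2%:R != 0 :> F.
Variable l : F.
Hypothesis l_neq0 : l != 0.
Hypothesis l_nonsquare : forall s, s ^+ 2 != l.

Let q : K := #|F|%:R.
Let zero : bqf F := bzero F.
Let u2 : bqf F := mkbqf 1 0 0.
Let uv : bqf F := mkbqf 0 1 0.
Let v2 : bqf F := mkbqf 0 0 1.
Let anis : bqf F := mkbqf 1 0 (- l).

(** The zero form is excluded: its discriminant vanishes, but it must not count as
    a form of the degenerate type. *)
Definition disc_wt (f : F -> K) (C : bqf F) : K :=
  if C == bzero F then 0 else f (disc C).

(** A substitution multiplies the discriminant by a nonzero square, and so does a
    scalar: hence the assumption on f. *)
Section SquareClassFunction.

Variable f : F -> K.
Hypothesis f_sqr : forall s d, s != 0 -> f (s ^+ 2 * d) = f d.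

Lemma disc_wt_act (g : 'M[F]_2) C :
  g \in unitmx -> disc_wt f (bact g C) = disc_wt f C.
Proof.
move=> Ug; rewrite /disc_wt -{1}(bact0 g) (inj_eq (can_inj (bactK Ug))).
by rewrite disc_act f_sqr // -unitfE -unitmxE.
Qed.

Lemma disc_wt_scale t C : t != 0 -> disc_wt f (bscale t C) = disc_wt f C.
Proof.
by move=> t_neq0; rewrite /disc_wt bscale_eq0 (negPf t_neq0) disc_scale f_sqr.
Qed.

(** Summing over all the triples of coefficients also counts the zero form, which
    contributes f 0. *)
Lemma sum_disc_wt (P : pred (bqf F)) : P (bzero F) ->
  \sum_C disc_wt f C * (P C)%:R =
  \sum_a \sum_b \sum_c f (b ^+ 2 - 4%:R * a * c) * (P (mkbqf a b c))%:R - f 0.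
Proof.
move=> P0; rewrite -(sum_bqf (fun C => f (disc C) * (P C)%:R)).
rewrite (bigD1 (bzero F)) //= [in RHS](bigD1 (bzero F)) //= P0.
rewrite {1}/disc_wt eqxx {1}/disc /bzero /cuu /cuv /cvv /= expr0n !mulr0 subr0.
rewrite mul0r add0r mulr1 addrAC subrr add0r; apply: eq_bigr => C C_neq0.
by rewrite /disc_wt (negPf C_neq0).
Qed.

Let S1 : K := \sum_d f d.
Let S2 : K := \sum_b f (b ^+ 2).
Let S3 : K := \sum_b \sum_c f (b ^+ 2 - 4%:R * l * c ^+ 2).

Lemma sum_nonzero_cst (a : K) : \sum_(s : F | s != 0) a = (q - 1) * a.
Proof.
have /eqP := sum_cst F a; rewrite (bigD1 0) //= addrC eq_sym -subr_eq.
by move=> /eqP <-; rewrite -/q; ring.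
Qed.

(** For a fixed nonzero a and any b, the discriminant takes every value exactly
    once as c varies; for a = 0 it is b ^ 2. *)
Lemma sum_forms : \sum_a \sum_b \sum_c f (b ^+ 2 - 4%:R * a * c) =
  q * (q - 1) * S1 + q * S2.
Proof.
rewrite (bigD1 0) //=.
under eq_bigr => b _.
  under eq_bigr => c _ do rewrite mulr0 mul0r subr0.
  rewrite sum_cst; over.
rewrite -mulr_sumr [X in _ + X](eq_bigr (fun=> q * S1)) => [|a a_neq0].
  by rewrite sum_nonzero_cst -/S2 -/q; ring.
rewrite -sum_cst; apply: eq_bigr => b _.
under eq_bigr => c _ do rewrite -mulNr.
by rewrite sum_shift // oppr_eq0 mulf_neq0 ?four0.
Qed.

Lemma perp_sumE x : perp_sum (disc_wt f) x =
  \sum_a \sum_b \sum_c f (b ^+ 2 - 4%:R * a * c) *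
    ((bqf_dot x.1 (mkbqf a b c) == 0) && (bqf_dot x.2 (mkbqf a b c) == 0))%:R
  - f 0.
Proof.
apply: (@sum_disc_wt (fun C => (bqf_dot x.1 C == 0) && (bqf_dot x.2 C == 0))).
by rewrite /bqf_dot /cuu /cuv /cvv /= !mulr0 mul0r !addr0 eqxx.
Qed.

Let dot0 C : (bqf_dot zero C == 0) = true.
Proof. by rewrite /bqf_dot /cuu /cuv /cvv /= !mul0r !addr0 eqxx. Qed.

Let dot_v2 a b c : (bqf_dot v2 (mkbqf a b c) == 0) = (c == 0).
Proof. by rewrite /bqf_dot /cuu /cuv /cvv /= !mul0r !add0r mul1r. Qed.

Let dot_u2 a b c : (bqf_dot u2 (mkbqf a b c) == 0) = (a == 0).
Proof. by rewrite /bqf_dot /cuu /cuv /cvv /= !mul0r !addr0 mul1r. Qed.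

Let dot_uv a b c : (bqf_dot uv (mkbqf a b c) == 0) = (b == 0).
Proof.
rewrite /bqf_dot /cuu /cuv /cvv /= !mul0r add0r addr0 mul1r mulf_eq0 invr_eq0.
by rewrite (negPf two0) orbF.
Qed.

Let dot_diag (k a b c : F) :
  (bqf_dot (mkbqf 1 0 k) (mkbqf a b c) == 0) = (a == - (k * c)).
Proof.
by rewrite /bqf_dot /cuu /cuv /cvv /= !mul0r addr0 mul1r addr_eq0.
Qed.

Lemma perp_sum_zero :
  perp_sum (disc_wt f) (zero, zero) = q * (q - 1) * S1 + q * S2 - f 0.
Proof.
rewrite perp_sumE -sum_forms; congr (_ - _).
by do 3!apply: eq_bigr => ? _; rewrite !dot0 mulr1.
Qed.

Lemma perp_sum_v2 : perp_sum (disc_wt f) (zero, v2) = q * S2 - f 0.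
Proof.
rewrite perp_sumE; congr (_ - _); rewrite -sum_cst; apply: eq_bigr => a _.
apply: eq_bigr => b _; under eq_bigr => c _ do rewrite dot0 dot_v2 /=.
by rewrite (sum_pick (fun c => f (b ^+ 2 - 4%:R * a * c))) mulr0 subr0.
Qed.

Lemma perp_sum_uv :
  perp_sum (disc_wt f) (zero, uv) = (q - 1) * S1 + (q - 1) * f 0.
Proof.
rewrite perp_sumE.
under eq_bigr => a _.
  rewrite exchange_big; under eq_bigr => c _.
    under eq_bigr => b _ do rewrite dot0 dot_uv /=.
    rewrite (sum_pick (fun b => f (b ^+ 2 - 4%:R * a * c))) expr0n; over.
  over.
rewrite (bigD1 0) //= (eq_bigr (fun=> f 0)) => [|c _]; last first.
  by rewrite mulr0 mul0r subr0.
rewrite sum_cst (eq_bigr (fun=> S1)) => [|a a_neq0]; last first.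
  under eq_bigr => c _ do rewrite -mulNr.
  by rewrite sum_shift // oppr_eq0 mulf_neq0 ?four0.
by rewrite sum_nonzero_cst -/q; ring.
Qed.

Lemma perp_sum_anis : perp_sum (disc_wt f) (zero, anis) = S3 - f 0.
Proof.
rewrite perp_sumE; congr (_ - _); rewrite exchange_big; apply: eq_bigr => b _.
rewrite exchange_big; apply: eq_bigr => c _ /=.
under eq_bigr => a _ do rewrite dot0 dot_diag mulNr opprK /=.
rewrite (sum_pick (fun a => f (b ^+ 2 - 4%:R * a * c))).
by congr f; ring.
Qed.

Lemma perp_sum_v2_uv : perp_sum (disc_wt f) (v2, uv) = (q - 1) * f 0.
Proof.
rewrite perp_sumE (eq_bigr (fun=> f 0)) => [|a _].
  by rewrite sum_cst -/q; ring.
under eq_bigr => b _.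
  under eq_bigr => c _ do rewrite dot_v2 dot_uv -mulnb natrM mulrA mulrAC.
  rewrite (sum_pick (fun c => f (b ^+ 2 - 4%:R * a * c) * (b == 0)%:R)) mulr0.
  rewrite subr0; over.
by rewrite (sum_pick (fun b => f (b ^+ 2))) expr0n.
Qed.

Lemma perp_sum_v2_u2 : perp_sum (disc_wt f) (v2, u2) = S2 - f 0.
Proof.
rewrite perp_sumE; congr (_ - _); rewrite exchange_big; apply: eq_bigr => b _.
under eq_bigr => a _.
  under eq_bigr => c _ do rewrite dot_v2 dot_u2 -mulnb natrM mulrA mulrAC.
  rewrite (sum_pick (fun c => f (b ^+ 2 - 4%:R * a * c) * (a == 0)%:R)) mulr0.
  rewrite subr0; over.
by rewrite (sum_pick (fun=> f (b ^+ 2))).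
Qed.

Lemma perp_sum_uv_diag :
  perp_sum (disc_wt f) (uv, mkbqf 1 0 l) = (q - 1) * f l.
Proof.
rewrite perp_sumE exchange_big.
under eq_bigr => b _.
  rewrite exchange_big; under eq_bigr => c _.
    under eq_bigr => a _ do rewrite dot_uv dot_diag -mulnb natrM mulrA.
    rewrite (sum_pick (fun a => f (b ^+ 2 - 4%:R * a * c) * (b == 0)%:R)); over.
  rewrite -mulr_suml; over.
rewrite (sum_pick (fun b => \sum_c f (b ^+ 2 - 4%:R * - (l * c) * c))).
rewrite (bigD1 0) //= (eq_bigr (fun=> f l)) => [|c c_neq0].
  by rewrite expr0n !mulr0 subr0 sum_nonzero_cst addrC addrK.
rewrite -[RHS](@f_sqr (2%:R * c)) ?mulf_neq0 //.
by congr f; ring.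
Qed.

Lemma ray_sum_zero :
  ray_sum (disc_wt f) (zero, zero) = q * (q - 1) * S1 + q * S2 - f 0.
Proof.
rewrite -perp_sum_zero /ray_sum /perp_sum; apply: eq_bigr => C _ /=.
rewrite !dot0 /=; have [->|C_neq0] := eqVneq C (bzero F).
  by rewrite /disc_wt eqxx !mul0r.
congr (_ * _); rewrite -[RHS](sum_pick1 K (0 : F)); apply: eq_bigr => s _.
rewrite -[RHS](sum_pick (fun=> _) (0 : F)); apply: eq_bigr => t _.
rewrite -natrM mulnb -pair_eqE /= ![zero == _]eq_sym !bscale_eq0.
by rewrite (negPf C_neq0) !orbF.
Qed.

(** The second component forces C = A / t with t nonzero, and all these forms have
    the weight of A. *)
Lemma ray_sum_form A : A != bzero F ->
  ray_sum (disc_wt f) (zero, A) = (q - 1) * f (disc A).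
Proof.
move=> A_neq0; rewrite /ray_sum.
have -> : \sum_C disc_wt f C * (\sum_s \sum_t ((zero, A) == ray s t C)%:R) =
          \sum_C \sum_t disc_wt f C * (A == bscale t C)%:R.
  apply: eq_bigr => C _; rewrite exchange_big mulr_sumr; apply: eq_bigr => t _ /=.
  have [->|C_neq0] := eqVneq C (bzero F); first by rewrite /disc_wt eqxx !mul0r.
  congr (_ * _); rewrite -[RHS](sum_pick (fun=> _) (0 : F)).
  apply: eq_bigr => s _; rewrite -natrM mulnb -pair_eqE /= [zero == _]eq_sym.
  by rewrite bscale_eq0 (negPf C_neq0) orbF andbC.
rewrite exchange_big (bigD1 0) //= big1 ?add0r => [|C _]; last first.
  by rewrite bscale0 (negPf A_neq0) mulr0.
rewrite -sum_nonzero_cst; apply: eq_bigr => t t_neq0.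
rewrite (bigD1 (bscale t^-1 A)) //= bscaleA mulfV // bscale1 eqxx mulr1.
rewrite big1 ?addr0 => [|C C_neq].
  by rewrite disc_wt_scale ?invr_eq0 // /disc_wt (negPf A_neq0).
have [def_A|_] := eqVneq A (bscale t C); last by rewrite mulr0.
by rewrite def_A bscaleA mulVf // bscale1 eqxx in C_neq.
Qed.

Lemma ray_sum_indep x : (forall s t C, x <> ray s t C) ->
  ray_sum (disc_wt f) x = 0.
Proof.
move=> indep; rewrite /ray_sum big1 // => C _; rewrite big1 ?mulr0 // => s _.
by rewrite big1 // => t _; case: eqP => // /indep.
Qed.

End SquareClassFunction.

End WeightedCounts.

(** * Invariant functions that separate the orbits *)

Section OrbitFunctions.

Variables (F : finFieldType) (K : numFieldType).
Hypothesis two0 : 2%:R != 0 :> F.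
Variable l : F.
Hypothesis l_neq0 : l != 0.
Hypothesis l_nonsquare : forall s, s ^+ 2 != l.

Let q : K := #|F|%:R.

(** Combinations of three functions suffice for the indicators of the zero, square
    and nonsquare classes, and are easier to sum than these indicators. *)
Definition sq_fun (a b c : K) (d : F) : K :=
  a + b * (d == 0)%:R + c * nroots K d.

Lemma sq_funM a b c s d : s != 0 -> sq_fun a b c (s ^+ 2 * d) = sq_fun a b c d.
Proof.
by move=> s_neq0; rewrite /sq_fun nrootsM // mulf_eq0 sqrf_eq0 (negPf s_neq0).
Qed.

Lemma sum_sq_fun (I : finType) (G : I -> F) a b c :
  \sum_i sq_fun a b c (G i) =
  a * #|I|%:R + b * \sum_i (G i == 0)%:R + c * \sum_i nroots K (G i).
Proof.
by rewrite /sq_fun !big_split /= -!mulr_sumr sumr_const mulr_natr.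
Qed.

Lemma sq_fun0 a b c : sq_fun a b c 0 = a + b + c.
Proof. by rewrite /sq_fun eqxx nroots0 !mulr1. Qed.

Lemma sq_fun1 a b c : sq_fun a b c 1 = a + 2%:R * c.
Proof.
have := @nroots_sqr F K two0 1 (oner_neq0 F); rewrite expr1n => n1.
by rewrite /sq_fun oner_eq0 n1 mulr0 addr0 mulrC.
Qed.

Lemma sq_funl a b c : sq_fun a b c l = a.
Proof. by rewrite /sq_fun (negPf l_neq0) nroots_nonsquare // !mulr0 !addr0. Qed.

Lemma sum_sq_fun_id a b c :
  \sum_d sq_fun a b c d = a * q + b + c * q.
Proof. by rewrite (sum_sq_fun id) sum_nroots sum_pick1 mulr1. Qed.

Lemma sum_sq_fun_sqr a b c :
  \sum_d sq_fun a b c (d ^+ 2) = a * q + b + c * (2%:R * q - 1).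
Proof.
rewrite (sum_sq_fun (fun d => d ^+ 2)) sum_nroots_sqr //.
by under eq_bigr => d _ do rewrite sqrf_eq0; rewrite sum_pick1 mulr1.
Qed.

(** Otherwise l would be the square of b / (2 c). *)
Lemma norm_form_eq0 b c : (b ^+ 2 - 4%:R * l * c ^+ 2 == 0) = (c == 0) && (b == 0).
Proof.
have [->|c_neq0] := eqVneq c 0; first by rewrite expr0n mulr0 subr0 sqrf_eq0.
apply/negP; rewrite subr_eq0 => /eqP b2.
have /negP := l_nonsquare (b / (2%:R * c)); apply; rewrite expr_div_n b2.
by apply/eqP; field; rewrite c_neq0.
Qed.

Lemma sum_sq_fun_norm a b c :
  \sum_x \sum_y sq_fun a b c (x ^+ 2 - 4%:R * l * y ^+ 2) =
  a * q ^+ 2 + b + c * q ^+ 2.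
Proof.
rewrite pair_bigA (sum_sq_fun (fun xy : F * F => xy.1 ^+ 2 - 4%:R * l * xy.2 ^+ 2)).
rewrite card_prod natrM -expr2 -/q; congr (_ + _ + _).
  rewrite -[RHS]mulr1 -[in RHS](sum_pick1 K (0 : F)); congr (_ * _).
  rewrite -(pair_bigA _ (fun x y => (x ^+ 2 - 4%:R * l * y ^+ 2 == 0)%:R)) /=.
  apply: eq_bigr => x _; rewrite -[RHS](sum_pick (fun=> _) (0 : F)).
  by apply: eq_bigr => y _; rewrite norm_form_eq0 -natrM mulnb andbC.
rewrite -(pair_bigA _ (fun x y => nroots K (x ^+ 2 - 4%:R * l * y ^+ 2))) /=.
by rewrite sum_nroots_norm.
Qed.

(** The types 0, 1 and 2 are those of discriminant zero, nonzero square and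
    nonsquare, for which the number of square roots is 1, 2 and 0; this
    determines the coefficients. Larger indices are read as type 2. *)
Definition type_wt (T : nat) : bqf F -> K :=
  disc_wt (match T with
           | 0 => sq_fun 0 1 0
           | 1 => sq_fun 0 (- 2%:R^-1) 2%:R^-1
           | _ => sq_fun 1 (- 2%:R^-1) (- 2%:R^-1)
           end).

(** The number of forms of type T. *)
Definition type_size (T : nat) : K :=
  match T with
  | 0 => q ^+ 2 - 1
  | 1 => q * (q ^+ 2 - 1) / 2%:R
  | _ => q * (q - 1) ^+ 2 / 2%:R
  end.

(** The number of forms of type T orthogonal to a given form of type T'; by
    invariance it may be computed at v^2, u v and u^2 - l v^2. *)
Definition incidence (T T' : nat) : K :=
  match T, T' with
  | 0, 0 => q - 1
  | 0, 1 => 2%:R * (q - 1)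
  | 0, _ => 0
  | 1, 0 => q * (q - 1)
  | _, 0 => 0
  | _, 1 => (q - 1) ^+ 2 / 2%:R
  | _, _ => (q ^+ 2 - 1) / 2%:R
  end.

Definition rep (i : nat) : bqf_pair F :=
  nth (mkbqf 0 0 0, mkbqf 0 0 0) (orbit_reps l) i.

Lemma type_wt_act T (g : 'M[F]_2) C :
  g \in unitmx -> type_wt T (bact g C) = type_wt T C.
Proof.
by move=> Ug; apply: disc_wt_act => // s d; case: T => [|[|T]]; apply: sq_funM.
Qed.

Lemma disc_anis : disc (mkbqf 1 0 (- l)) = 2%:R ^+ 2 * l.
Proof. by rewrite /disc /cuu /cuv /cvv /=; ring. Qed.

Lemma perp_sum_sq_fun a b c i : (i < 7)%N ->
  perp_sum (disc_wt (sq_fun a b c)) (rep i) =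
  match i with
  | 0 => q * (q - 1) * (a * q + b + c * q)
         + q * (a * q + b + c * (2%:R * q - 1)) - (a + b + c)
  | 1 => q * (a * q + b + c * (2%:R * q - 1)) - (a + b + c)
  | 2 => (q - 1) * (a * q + b + c * q) + (q - 1) * (a + b + c)
  | 3 => a * q ^+ 2 + b + c * q ^+ 2 - (a + b + c)
  | 4 => (q - 1) * (a + b + c)
  | 5 => a * q + b + c * (2%:R * q - 1) - (a + b + c)
  | _ => (q - 1) * a
  end.
Proof.
case: i => [|[|[|[|[|[|[|//]]]]]]] _; rewrite /rep /=.
- rewrite (perp_sum_zero two0).
  by rewrite sum_sq_fun_id sum_sq_fun_sqr sq_fun0.
- by rewrite perp_sum_v2 sum_sq_fun_sqr sq_fun0.
- by rewrite (perp_sum_uv two0) sum_sq_fun_id sq_fun0.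
- by rewrite (perp_sum_anis l) sum_sq_fun_norm sq_fun0.
- by rewrite (perp_sum_v2_uv two0) sq_fun0.
- by rewrite perp_sum_v2_u2 sum_sq_fun_sqr sq_fun0.
by rewrite (perp_sum_uv_diag two0 l (@sq_funM a b c)) sq_funl.
Qed.

Lemma ray_sum_sq_fun a b c i : (i < 7)%N ->
  ray_sum (disc_wt (sq_fun a b c)) (rep i) =
  match i with
  | 0 => q * (q - 1) * (a * q + b + c * q)
         + q * (a * q + b + c * (2%:R * q - 1)) - (a + b + c)
  | 1 => (q - 1) * (a + b + c)
  | 2 => (q - 1) * (a + 2%:R * c)
  | 3 => (q - 1) * a
  | _ => 0
  end.
Proof.
have fM := @sq_funM a b c.
have neq0 (x y z : F) : (x != 0) || (y != 0) || (z != 0) ->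
    mkbqf x y z != bzero F.
  by apply: contraL => /eqP[-> -> ->]; rewrite eqxx.
case: i => [|[|[|[|[|[|[|//]]]]]]] _; rewrite /rep /=.
- rewrite (ray_sum_zero two0).
  by rewrite sum_sq_fun_id sum_sq_fun_sqr sq_fun0.
- rewrite (ray_sum_form fM) ?neq0 ?oner_neq0 ?orbT // -sq_fun0.
  by congr (_ * sq_fun _ _ _ _); rewrite /disc /cuu /cuv /cvv /=; ring.
- rewrite (ray_sum_form fM) ?neq0 ?oner_neq0 ?orbT // -(sq_fun1 a b c).
  by congr (_ * sq_fun _ _ _ _); rewrite /disc /cuu /cuv /cvv /=; ring.
- rewrite (ray_sum_form fM) ?neq0 ?oner_neq0 ?orbT // disc_anis.
  by rewrite fM // sq_funl.
- apply: ray_sum_indep => s t [[x y] z] [_ sy0 sz1 _ ty1 _]; move: sz1 ty1 sy0.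
  rewrite /cuu /cuv /cvv /= => sz1 ty1 /esym/eqP; rewrite mulf_eq0.
  by case/orP => /eqP e0; [move: sz1 | move: ty1];
    rewrite e0 ?mul0r ?mulr0 => /eqP; rewrite oner_eq0.
- apply: ray_sum_indep => s t [[x y] z] [sx0 _ sz1 tx1 _ _]; move: sz1 tx1 sx0.
  rewrite /cuu /cuv /cvv /= => sz1 tx1 /esym/eqP; rewrite mulf_eq0.
  by case/orP => /eqP e0; [move: sz1 | move: tx1];
    rewrite e0 ?mul0r ?mulr0 => /eqP; rewrite oner_eq0.
apply: ray_sum_indep => s t [[x y] z] [sx0 sy1 _ tx1 _ _]; move: sy1 tx1 sx0.
rewrite /cuu /cuv /cvv /= => sy1 tx1 /esym/eqP; rewrite mulf_eq0.
by case/orP => /eqP e0; [move: sy1 | move: tx1];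
  rewrite e0 ?mul0r ?mulr0 => /eqP; rewrite oner_eq0.
Qed.

(** A pair that spans a plane is orthogonal to the q - 1 nonzero multiples of one
    form only, which gives the last three values. *)
Lemma perp_sum_rep T i : (i < 7)%N ->
  perp_sum (type_wt T) (rep i) =
  match i with
  | 0 => type_size T
  | i'.+4 => (q - 1) * (minn T 2 == i')%:R
  | i'.+1 => incidence T i'
  end.
Proof.
move=> lt_i; rewrite /type_wt; case: T => [|[|T]]; rewrite perp_sum_sq_fun //;
  case: i lt_i => [|[|[|[|[|[|[|//]]]]]]] _ /=; by rewrite ?minnSS; field.
Qed.

Lemma ray_sum_rep T i : (i < 7)%N ->
  ray_sum (type_wt T) (rep i) =
  match i with
  | 0 => type_size T
  | i'.+1 => (q - 1) * (minn T 2 == i')%:R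
  end.
Proof.
move=> lt_i; rewrite /type_wt; case: T => [|[|T]]; rewrite ray_sum_sq_fun //;
  by case: i lt_i => [|[|[|[|[|[|[|//]]]]]]] _ /=; rewrite ?minnSS; field.
Qed.

Definition zero_fun (x : bqf_pair F) : K := (x == (bzero F, bzero F))%:R.

(** The ray sum of a nonzero pair (s A, t A) runs over the q - 1 nonzero multiples
    of A, and that of an independent pair is empty; at zero it counts all the
    forms of type T. *)
Definition line_fun T x : K :=
  (ray_sum (type_wt T) x - type_size T * zero_fun x) / (q - 1).

(** The transform of line_fun: ray sums become perp sums, and the indicator of
    zero becomes the constant 1. *)
Definition line_fun_hat T y : K :=
  (q ^+ 2 * perp_sum (type_wt T) y - type_size T) / (q - 1).

(** The perp sum is supported on the plane of type T, on the pairs that span a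
    line, where it is given by incidence, and at zero. *)
Definition plane_fun T x : K :=
  (perp_sum (type_wt T) x - type_size T * zero_fun x
   - \sum_(T' < 3) incidence T T' * line_fun T' x) / (q - 1).

Definition plane_fun_hat T y : K :=
  (q ^+ 4 * ray_sum (type_wt T) y - type_size T
   - \sum_(T' < 3) incidence T T' * line_fun_hat T' y) / (q - 1).

Definition orbit_fun (j : nat) : bqf_pair F -> K :=
  match j with
  | 0 => zero_fun
  | j'.+4 => plane_fun j'
  | j'.+1 => line_fun j'
  end.

Definition orbit_fun_hat (j : nat) : bqf_pair F -> K :=
  match j with
  | 0 => fun=> 1
  | j'.+4 => plane_fun_hat j'
  | j'.+1 => line_fun_hat j'
  end.

Lemma q_neq1 : q - 1 != 0.
Proof.
rewrite subr_eq0 pnatr_eq1; apply/eqP => q1.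
have := max_card (pred2 (0 : F) 1); rewrite card2 q1.
by rewrite eq_sym oner_neq0.
Qed.

Lemma zero_fun_rep i : (i < 7)%N -> zero_fun (rep i) = (i == 0%N)%:R.
Proof.
move=> lt_i; rewrite /zero_fun /rep; congr (_%:R); congr nat_of_bool.
case: i lt_i => [|[|[|[|[|[|[|//]]]]]]] _ /=; first exact: eqxx.
all: by apply/eqP => -[] *; case/eqP: (oner_neq0 F).
Qed.

Lemma orbit_fun_rep i j : (i < 7)%N -> (j < 7)%N ->
  orbit_fun j (rep i) = (i == j)%:R.
Proof.
move=> lt_i lt_j.
have q1 := q_neq1.
case: j lt_j => [|[|[|[|[|[|[|//]]]]]]] _; rewrite /orbit_fun ?zero_fun_rep //;
  rewrite /plane_fun ?big_ord_recl ?big_ord0 /line_fun;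
  rewrite ?perp_sum_rep // ?ray_sum_rep // ?zero_fun_rep //;
  case: i lt_i => [|[|[|[|[|[|[|//]]]]]]] _ /=; by field.
Qed.

Lemma orbit_fun_hat_rep i j : (i < 7)%N -> (j < 7)%N ->
  orbit_fun_hat j (rep i) = nth 0 (nth [::] (table_rows q) i) j.
Proof.
move=> lt_i lt_j.
have q1 := q_neq1.
case: j lt_j => [|[|[|[|[|[|[|//]]]]]]] _; rewrite /orbit_fun_hat;
  rewrite ?/plane_fun_hat ?big_ord_recl ?big_ord0 ?/line_fun_hat;
  rewrite ?perp_sum_rep // ?ray_sum_rep //;
  case: i lt_i => [|[|[|[|[|[|[|//]]]]]]] _ /=; by field.
Qed.

End OrbitFunctions.

(** * Transforms of the orbit indicators *)

Section OrbitTransforms.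

Variables (F : finFieldType) (K : numFieldType).
Hypothesis two0 : 2%:R != 0 :> F.
Variable l : F.
Hypothesis l_neq0 : l != 0.
Hypothesis l_nonsquare : forall s, s ^+ 2 != l.

Let q : K := #|F|%:R.

Lemma pair_act0 (g1 g2 : 'M[F]_2) :
  pair_act g1 g2 (bzero F, bzero F) = (bzero F, bzero F).
Proof.
by rewrite /pair_act /= bact0; congr (_, _); apply: bqfP;
  rewrite /bcomb /cuu /cuv /cvv /= !mulr0 addr0.
Qed.

Lemma zero_fun_act (g1 g2 : 'M[F]_2) x : g1 \in unitmx -> g2 \in unitmx ->
  zero_fun K (pair_act g1 g2 x) = zero_fun K x.
Proof.
move=> U1 U2; rewrite /zero_fun -{1}(pair_act0 g1 g2).
by rewrite (can_eq (pair_actK U1 U2)).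
Qed.

Lemma orbit_fun_act j (g1 g2 : 'M[F]_2) x : g1 \in unitmx -> g2 \in unitmx ->
  orbit_fun K j (pair_act g1 g2 x) = orbit_fun K j x.
Proof.
move=> U1 U2; have w_act T := @type_wt_act F K T.
have line_act T : line_fun K T (pair_act g1 g2 x) = line_fun K T x.
  by rewrite /line_fun (ray_sum_act (w_act T)) // zero_fun_act.
have plane_act T : plane_fun K T (pair_act g1 g2 x) = plane_fun K T x.
  rewrite /plane_fun (perp_sum_act two0 (w_act T)) // zero_fun_act //.
  by under eq_bigr => T' _ do rewrite line_act.
by case: j => [|[|[|[|j]]]]; rewrite /orbit_fun ?zero_fun_act.
Qed.

Lemma orbit_fun_hat_act j (g1 g2 : 'M[F]_2) x :
    g1 \in unitmx -> g2 \in unitmx ->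
  orbit_fun_hat K j (pair_act g1 g2 x) = orbit_fun_hat K j x.
Proof.
move=> U1 U2; have w_act T := @type_wt_act F K T.
have line_act T : line_fun_hat K T (pair_act g1 g2 x) = line_fun_hat K T x.
  by rewrite /line_fun_hat (perp_sum_act two0 (w_act T)).
have plane_act T : plane_fun_hat K T (pair_act g1 g2 x) = plane_fun_hat K T x.
  rewrite /plane_fun_hat (ray_sum_act (w_act T)) //.
  by under eq_bigr => T' _ do rewrite line_act.
by case: j => [|[|[|[|j]]]]; rewrite /orbit_fun_hat.
Qed.

Lemma orbit_fun_orbit x (i : 'I_7) j : (j < 7)%N -> x \in calO l i ->
  orbit_fun K j x = ((i : nat) == j)%:R.
Proof.
move=> lt_j /(in_orbitP two0)[g1 [g2 [U1 U2 ->]]].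
by rewrite orbit_fun_act // orbit_fun_rep.
Qed.

Lemma orbit_fun_hat_orbit x (i : 'I_7) j : (j < 7)%N -> x \in calO l i ->
  orbit_fun_hat K j x = nth 0 (nth [::] (table_rows q) i) j.
Proof.
move=> lt_j /(in_orbitP two0)[g1 [g2 [U1 U2 ->]]].
by rewrite orbit_fun_hat_act // (orbit_fun_hat_rep K two0 l_neq0).
Qed.

(** The function orbit_fun i equals 1 on the orbit i and 0 on the orbit j. *)
Lemma in_calO x (i j : 'I_7) : x \in calO l i -> (x \in calO l j) = (i == j).
Proof.
move=> xi; have [<-//|neq_ij] := eqVneq i j; apply/negP => xj.
have := orbit_fun_orbit (ltn_ord i) xj; rewrite (orbit_fun_orbit (ltn_ord i) xi).
by rewrite eqxx val_eqE eq_sym (negPf neq_ij) => /eqP; rewrite oner_eq0.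
Qed.

Lemma calO_orbit_fun x (j : 'I_7) : (x \in calO l j)%:R = orbit_fun K j x.
Proof.
have [i xi] := orbits_cover two0 l_neq0 l_nonsquare x.
by rewrite (in_calO _ xi) (orbit_fun_orbit (ltn_ord j) xi).
Qed.

Variable psi : F -> K.
Hypothesis psiD : {morph psi : a b / a + b >-> a * b}.
Hypothesis psi0 : psi 0 = 1.
Hypothesis psi_neq1 : exists a, psi a != 1.

Lemma ftrans_line T y : ftrans psi (line_fun K T) y = line_fun_hat K T y.
Proof.
rewrite /ftrans /line_fun /line_fun_hat.
under eq_bigr => x _ do rewrite mulrAC mulrBl -mulrA.
rewrite -mulr_suml sumrB -mulr_sumr; congr ((_ - _) / _).
  exact: (ftrans_ray psiD psi0 psi_neq1).
by rewrite -[X in _ * X]/(ftrans psi (zero_fun K) y) ftrans_zero // mulr1.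
Qed.

Lemma ftrans_plane T y : ftrans psi (plane_fun K T) y = plane_fun_hat K T y.
Proof.
rewrite /ftrans /plane_fun /plane_fun_hat.
under eq_bigr => x _ do
  rewrite mulrAC mulrBl [X in (X - _) / _]mulrBl -(mulrA (type_size _ _ _)).
rewrite -mulr_suml !sumrB; congr ((_ - _ - _) / _).
- exact: (ftrans_perp psiD psi0 psi_neq1 two0).
- by rewrite -mulr_sumr -[X in _ * X]/(ftrans psi (zero_fun K) y) ftrans_zero // mulr1.
under eq_bigr => x _ do rewrite mulr_suml.
rewrite exchange_big; apply: eq_bigr => T' _ /=; rewrite -ftrans_line mulr_sumr.
by apply: eq_bigr => x _; rewrite mulrA.
Qed.

Lemma ftrans_orbit_fun j y : ftrans psi (orbit_fun K j) y = orbit_fun_hat K j y.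
Proof.
case: j => [|[|[|[|j]]]]; rewrite ?ftrans_plane ?ftrans_line //.
exact: ftrans_zero.
Qed.

Lemma ftrans_calO (i j : 'I_7) y : y \in calO l i ->
  ftrans psi (fun x => (x \in calO l j)%:R) y = table q i j.
Proof.
move=> yi; rewrite mxE -(orbit_fun_hat_orbit (ltn_ord j) yi) -ftrans_orbit_fun.
by apply: eq_bigr => x _; rewrite calO_orbit_fun.
Qed.

End OrbitTransforms.

Theorem theorem21 (R : realType) (F : finFieldType) (p : nat)
    (charFp : p \in [pchar F]) (p_neq2 : p <> 2%N)
    (l : F) (l_neq0 : l <> 0) (l_nonsquare : ~ exists s : F, s ^+ 2 = l) :
  (exists! M : 'M[R[i]]_7, is_fourier_matrix charFp l M) /\
  (forall M : 'M[R[i]]_7, is_fourier_matrix charFp l M ->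
     #|F|%:R ^+ 6 *: M = table (#|F|%:R : R[i])).
Proof.
have two0 : 2%:R != 0 :> F.
  apply/eqP => two0; apply: p_neq2.
  have := dvdn_pcharf charFp 2; rewrite two0 eqxx dvdn_prime2 ?(pcharf_prime charFp) //.
  by move/eqP.
have l0 : l != 0 by apply/eqP.
have nsq s : s ^+ 2 != l by apply/eqP => sl; apply: l_nonsquare; exists s.
pose q : R[i] := #|F|%:R.
have q6 : q ^+ 6 != 0 by rewrite expf_neq0 ?q_neq0.
have indic_fourier (i j : 'I_7) y : y \in calO l i ->
    fourier charFp (indic R l j) y = q ^- 6 * table q i j.
  move=> yi; rewrite -(ftrans_calO two0 l0 nsq (addcharD R charFp) _ _ j yi) //.
    exact: addchar0.
  exact: addchar_neq1.
have sum_indic (M : 'M[R[i]]_7) (i j : 'I_7) y : y \in calO l i ->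
    \sum_(k < 7) M k j * indic R l k y = M i j.
  move=> yi; rewrite (bigD1 i) //= /indic yi mulr1 big1 ?addr0 // => k neq_ki.
  by rewrite (in_calO rat two0 l0 nsq _ yi) eq_sym (negPf neq_ki) mulr0.
have forced (M : 'M[R[i]]_7) : is_fourier_matrix charFp l M -> M = q ^- 6 *: table q.
  move=> fM; apply/matrixP => i j; rewrite [in RHS]mxE.
  have yi : nth (mkbqf 0 0 0, mkbqf 0 0 0) (orbit_reps l) i \in calO l i.
    exact: orbit_refl.
  by rewrite -(indic_fourier i j _ yi) fM (sum_indic M i j _ yi).
split; last by move=> M /forced->; rewrite scalerA mulfV // scale1r.
exists (q ^- 6 *: table q); split=> [j y|M /forced //].
have [i yi] := orbits_cover two0 l0 nsq y.
by rewrite (indic_fourier i j y yi) (sum_indic _ i j y yi) [in RHS]mxE.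
Qed.
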